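(* Let $K$ be an algebraically closed field of characteristic zero, $n\ge 1$, $r,s\ge 0$ integers, and $G=\mathrm{GL}(n)$ over $K$. Let $I(n,r,s)$ be the two-sided ideal of $Dist(G)=U(\mathfrak{gl}_n)$ generated by the elements $\sum_{i=1}^n H_i-r+s$, the elements $\prod_{k=-r}^{s}(H_i+k)$ for $i=1,\ldots,n$, and the elements $\prod_{k=-r}^{s}(H_S+k)$ for every proper subset $S$ of $\{1,\ldots,n\}$, where $H_S=\sum_{i\in S}H_i$. Then the rational Schur algebra $S(n,r,s)$ is the factor algebra of $Dist(G)$ modulo the ideal $I(n,r,s)$, i.e. $S(n,r,s)\simeq Dist(G)/I(n,r,s)$.
   Context: $E=K^n$ is the natural $G$-module. In characteristic zero the distribution algebra $Dist(G)$ is the universal enveloping algebra $U(\mathfrak{gl}_n)$; for the diagonal torus $T$, $Dist(T)=K[H_1,\ldots,H_n]$ is the polynomial algebra with $H_i$ corresponding to the matrix unit $e_{ii}$. Let $c_{ij}$ be the coordinate functions of the generic matrix $C$ and $d_{ij}$ the entries of $C^{-1}$. Let $A(n,r,s)\subset K[G]$ be the span of all products $\prod c_{ij}^{a_{ij}}\prod d_{ij}^{b_{ij}}$ with $a_{ij},b_{ij}\geq 0$, $\sum a_{ij}=r$, $\sum b_{ij}=s$; it is a subcoalgebra of $K[G]$. The rational Schur algebra is the dual algebra $S(n,r,s)=A(n,r,s)^*=\mathrm{Hom}_K(A(n,r,s),K)$. It is identified with the image of the natural representation $\rho_{r,s}:Dist(G)\to \mathrm{End}_K(E^{\otimes r}\otimes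 (E^* )^{\otimes s})$. *)

(* Defs.v *)
From HB Require Import structures.
From mathcomp Require Import all_boot all_order all_algebra.
From mathcomp Require Import boolp functions.
From mathcomp Require Import monalg.

Set Implicit Arguments.
Unset Strict Implicit.
Unset Printing Implicit Defensive.

Import GRing.Theory.
Local Open Scope ring_scope.
Local Open Scope quotient_scope.

Inductive two_sided_ideal (A : pzRingType) (P : A -> Prop) : A -> Prop :=
| ideal_gen x : P x -> two_sided_ideal P x
| ideal_0 : two_sided_ideal P 0
| ideal_D x y :
    two_sided_ideal P x -> two_sided_ideal P y -> two_sided_ideal P (x + y)
| ideal_Ml a x : two_sided_ideal P x -> two_sided_ideal P (a * x)
| ideal_Mr a x : two_sided_ideal P x -> two_sided_ideal P (x * a).

Section QuotientAlgebra.
Variables (K : fieldType) (A : algType K) (P : A -> Prop).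
Local Notation I := (two_sided_ideal P).

Lemma ideal_N x : I x -> I (- x).
Proof. by rewrite -mulN1r; exact: ideal_Ml. Qed.

Definition quot_rel (x y : A) : bool := `[< I (x - y) >].

Lemma quot_rel_refl : reflexive quot_rel.
Proof. by move=> x; apply/asboolP; rewrite subrr; exact: ideal_0. Qed.

Lemma quot_rel_sym : symmetric quot_rel.
Proof.
by move=> x y; apply/asboolP/asboolP => /ideal_N; rewrite opprB.
Qed.

Lemma quot_rel_trans : transitive quot_rel.
Proof.
move=> y x z /asboolP xy /asboolP yz; apply/asboolP.
by have := ideal_D xy yz; rewrite addrA subrK.
Qed.

Canonical quot_equiv :=
  EquivRel quot_rel quot_rel_refl quot_rel_sym quot_rel_trans.

Definition quot_alg : Type := {eq_quot quot_rel}.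
HB.instance Definition _ := Choice.on quot_alg.
HB.instance Definition _ := EqQuotient.on quot_alg.

Definition quot_proj (x : A) : quot_alg := \pi_quot_alg x.

Lemma quot_projP x y : quot_proj x = quot_proj y <-> I (x - y).
Proof.
split=> [/eqmodP /asboolP //|Ixy]; apply/eqmodP; exact/asboolP.
Qed.

Lemma quot_reprP x : I (repr (quot_proj x) - x).
Proof. by apply/quot_projP; rewrite /quot_proj reprK. Qed.

Lemma quot_projK (q : quot_alg) : quot_proj (repr q) = q.
Proof. exact: reprK. Qed.

Definition quot_add (p q : quot_alg) := quot_proj (repr p + repr q).
Definition quot_opp (p : quot_alg) := quot_proj (- repr p).
Definition quot_mul (p q : quot_alg) := quot_proj (repr p * repr q).
Definition quot_scale (k : K) (p : quot_alg) := quot_proj (k *: repr p).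

Lemma quot_addE x y : quot_add (quot_proj x) (quot_proj y) = quot_proj (x + y).
Proof.
apply/quot_projP; rewrite opprD addrACA.
by apply: ideal_D; exact: quot_reprP.
Qed.

Lemma quot_oppE x : quot_opp (quot_proj x) = quot_proj (- x).
Proof. by apply/quot_projP; rewrite -opprD; apply: ideal_N; exact: quot_reprP. Qed.

Lemma quot_mulE x y : quot_mul (quot_proj x) (quot_proj y) = quot_proj (x * y).
Proof.
apply/quot_projP; set x' := repr _; set y' := repr _.
have -> : x' * y' - x * y = (x' - x) * y' + x * (y' - y).
  by rewrite mulrBl mulrBr addrA subrK.
by apply: ideal_D; [apply: ideal_Mr|apply: ideal_Ml]; exact: quot_reprP.
Qed.

Lemma quot_scaleE k x : quot_scale k (quot_proj x) = quot_proj (k *: x).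
Proof.
apply/quot_projP; rewrite -scalerBr -mulr_algl.
by apply: ideal_Ml; exact: quot_reprP.
Qed.

Lemma quot_ind (Q : quot_alg -> Prop) : (forall x, Q (quot_proj x)) -> forall q, Q q.
Proof. by move=> Qx q; rewrite -(quot_projK q). Qed.

Fact quot_addA : associative quot_add.
Proof.
by elim/quot_ind=> x; elim/quot_ind=> y; elim/quot_ind=> z; rewrite !quot_addE addrA.
Qed.
Fact quot_addC : commutative quot_add.
Proof. by elim/quot_ind=> x; elim/quot_ind=> y; rewrite !quot_addE addrC. Qed.
Fact quot_add0 : left_id (quot_proj 0) quot_add.
Proof. by elim/quot_ind=> x; rewrite quot_addE add0r. Qed.
Fact quot_addN : left_inverse (quot_proj 0) quot_opp quot_add.
Proof. by elim/quot_ind=> x; rewrite quot_oppE quot_addE addNr. Qed.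

HB.instance Definition _ :=
  GRing.isZmodule.Build quot_alg quot_addA quot_addC quot_add0 quot_addN.

Fact quot_mulA : associative quot_mul.
Proof.
by elim/quot_ind=> x; elim/quot_ind=> y; elim/quot_ind=> z; rewrite !quot_mulE mulrA.
Qed.
Fact quot_mul1r : left_id (quot_proj 1) quot_mul.
Proof. by elim/quot_ind=> x; rewrite quot_mulE mul1r. Qed.
Fact quot_mulr1 : right_id (quot_proj 1) quot_mul.
Proof. by elim/quot_ind=> x; rewrite quot_mulE mulr1. Qed.
Fact quot_mulDl : left_distributive quot_mul quot_add.
Proof.
elim/quot_ind=> x; elim/quot_ind=> y; elim/quot_ind=> z.
by rewrite !(quot_mulE, quot_addE) mulrDl.
Qed.
Fact quot_mulDr : right_distributive quot_mul quot_add.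
Proof.
elim/quot_ind=> x; elim/quot_ind=> y; elim/quot_ind=> z.
by rewrite !(quot_mulE, quot_addE) mulrDr.
Qed.

HB.instance Definition _ := GRing.Zmodule_isPzRing.Build quot_alg
  quot_mulA quot_mul1r quot_mulr1 quot_mulDl quot_mulDr.

Fact quot_scaleA a b v : quot_scale a (quot_scale b v) = quot_scale (a * b) v.
Proof. by elim/quot_ind: v => x; rewrite !quot_scaleE scalerA. Qed.
Fact quot_scale1 : left_id 1 quot_scale.
Proof. by elim/quot_ind=> x; rewrite quot_scaleE scale1r. Qed.
Fact quot_scaleDr : right_distributive quot_scale +%R.
Proof.
move=> a; elim/quot_ind=> x; elim/quot_ind=> y.
by rewrite [_ + _]quot_addE !quot_scaleE scalerDr [RHS]quot_addE.
Qed.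
Fact quot_scaleDl v : {morph quot_scale^~ v : a b / a + b}.
Proof.
by elim/quot_ind: v => x a b; rewrite !quot_scaleE scalerDl [RHS]quot_addE.
Qed.

HB.instance Definition _ := GRing.Zmodule_isLmodule.Build K quot_alg
  quot_scaleA quot_scale1 quot_scaleDr quot_scaleDl.

Lemma quot_proj_linear : linear quot_proj.
Proof.
move=> a x y; have -> : a *: quot_proj x = quot_proj (a *: x).
  exact: quot_scaleE.
by rewrite [RHS]quot_addE.
Qed.

Lemma quot_proj_monoid : monoid_morphism quot_proj.
Proof. by split=> // x y; rewrite [RHS]quot_mulE. Qed.

HB.instance Definition _ :=
  GRing.isLinear.Build K A quot_alg _ quot_proj quot_proj_linear.
HB.instance Definition _ :=
  GRing.isMonoidMorphism.Build A quot_alg quot_proj quot_proj_monoid.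

Fact quot_scaleAl k (u v : quot_alg) : k *: (u * v) = (k *: u) * v.
Proof.
elim/quot_ind: u => x; elim/quot_ind: v => y.
by rewrite -rmorphM -!linearZ -rmorphM /= scalerAl.
Qed.
Fact quot_scaleAr k (u v : quot_alg) : k *: (u * v) = u * (k *: v).
Proof.
elim/quot_ind: u => x; elim/quot_ind: v => y.
by rewrite -rmorphM -!linearZ -rmorphM /= scalerAr.
Qed.

End QuotientAlgebra.

Section Enveloping.
Variables (K : fieldType) (n : nat).

(* The free associative algebra on the underlying set of gl_n; its quotient by
   [env_rel] is the tensor algebra of the vector space gl_n modulo
   [X, Y] = X (x) Y - Y (x) X. *)
Definition free_alg : Type := {malg K[{fmonom 'M[K]_n}]}.
HB.instance Definition _ := GRing.Lalgebra.on free_alg.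

Fact free_scaleAr k (x y : free_alg) : k *: (x * y) = x * (k *: y).
Proof.
have comk : x * malgC k = malgC k * x :> free_alg.
  rewrite [LHS]malgM_def [RHS]malgM_def fgmulUg fgmulgU.
  by apply: eq_bigr => m _; rewrite mulm1 mul1m mulrC.
have kE (z : free_alg) : k *: z = malgC k * z :> free_alg by rewrite mul_malgC.
by rewrite !kE !mulrA comk.
Qed.

HB.instance Definition _ :=
  GRing.Lalgebra_isAlgebra.Build K free_alg free_scaleAr.

Definition free_gen (X : 'M[K]_n) : free_alg := mkmalgU (fmu X) 1.

Inductive env_rel : free_alg -> Prop :=
| env_linear (a : K) (X Y : 'M[K]_n) :
    env_rel (free_gen (a *: X + Y) - (a *: free_gen X + free_gen Y))
| env_bracket (X Y : 'M[K]_n) :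
    env_rel (free_gen (X *m Y - Y *m X)
             - (free_gen X * free_gen Y - free_gen Y * free_gen X)).

(* U(gl_n), i.e. Dist(GL_n) in characteristic zero. *)
Definition Ugl : Type := quot_alg env_rel.
HB.instance Definition _ := GRing.Lmodule.on Ugl.
HB.instance Definition _ := GRing.PzRing.on Ugl.

Local Notation augm := (@mcoeff {fmonom 'M[K]_n} K (@mone {fmonom 'M[K]_n})).

Lemma env_ideal_augmentation (x : free_alg) :
  two_sided_ideal env_rel x -> augm x = 0.
Proof.
have gen0 X : augm (free_gen X) = 0 :> K.
  by rewrite mcoeffU -val_eqE /= fm1 fmU.
have eM (u v : free_alg) : augm (u * v) = augm u * augm v.
  exact: (rmorphM augm).
have eB (u v : free_alg) : augm (u - v) = augm u - augm v.
  exact: mcoeffB.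
have eD (u v : free_alg) : augm (u + v) = augm u + augm v.
  exact: mcoeffD.
have eZ a (u : free_alg) : augm (a *: u) = a * augm u.
  exact: mcoeffZ.
elim=> [_ [a X Y|X Y]||u v _ u0 _ v0|a u _ u0|a u _ u0].
- by rewrite eB eD eZ !gen0 mulr0 addr0 subrr.
- by rewrite !(eB, eM) !gen0 mulr0 !subrr.
- exact: mcoeff0.
- by rewrite eD u0 v0 addr0.
- by rewrite eM u0 mulr0.
- by rewrite eM u0 mul0r.
Qed.

Fact Ugl_nontrivial : 1 != 0 :> Ugl.
Proof.
apply/eqP => /quot_projP; rewrite subr0 => /env_ideal_augmentation.
by rewrite mcoeff1 eqxx => /eqP; rewrite oner_eq0.
Qed.

HB.instance Definition _ := GRing.PzSemiRing_isNonZero.Build Ugl Ugl_nontrivial.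
HB.instance Definition _ :=
  GRing.Lmodule_isLalgebra.Build K Ugl (@quot_scaleAl K free_alg env_rel).
HB.instance Definition _ :=
  GRing.Lalgebra_isAlgebra.Build K Ugl (@quot_scaleAr K free_alg env_rel).

Definition Ugl_in (X : 'M[K]_n) : Ugl := quot_proj env_rel (free_gen X).

Lemma Ugl_in_linear : linear Ugl_in.
Proof.
move=> a X Y; rewrite /Ugl_in -linearP.
by apply/quot_projP; apply: ideal_gen; exact: env_linear.
Qed.
HB.instance Definition _ :=
  GRing.isLinear.Build K 'M[K]_n Ugl _ Ugl_in Ugl_in_linear.

Lemma Ugl_in_bracket X Y :
  Ugl_in (X *m Y - Y *m X) = Ugl_in X * Ugl_in Y - Ugl_in Y * Ugl_in X.
Proof.
rewrite /Ugl_in -[X in _ = X - _]rmorphM -[X in _ = _ - X]rmorphM -linearB.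
by apply/quot_projP; apply: ideal_gen; exact: env_bracket.
Qed.

Definition Hgen (i : 'I_n) : Ugl := Ugl_in (delta_mx i i).

Definition Hset (S : {set 'I_n}) : Ugl := \sum_(i in S) Hgen i.

(* prod_{k = -r}^{s} (h + k), reindexed by k = j - r. *)
Definition shifted_prod (r s : nat) (h : Ugl) : Ugl :=
  \prod_(0 <= j < (r + s).+1) (h + (j%:Z - r%:Z)%:~R).

Inductive rat_rel (r s : nat) : Ugl -> Prop :=
| rat_rel_total : rat_rel r s (\sum_i Hgen i - r%:R + s%:R)
| rat_rel_single (i : 'I_n) : rat_rel r s (shifted_prod r s (Hgen i))
| rat_rel_proper (S : {set 'I_n}) :
    S \proper [set: 'I_n] -> rat_rel r s (shifted_prod r s (Hset S)).

End Enveloping.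

Inductive lin_span (K : fieldType) (V : lmodType K) (P : V -> Prop) : V -> Prop :=
| span_gen v : P v -> lin_span P v
| span_0 : lin_span P 0
| span_D u v : lin_span P u -> lin_span P v -> lin_span P (u + v)
| span_Z a v : lin_span P v -> lin_span P (a *: v).

Section Dual.
Variables (K : fieldType) (V : lmodType K).

Definition linear_form : {pred V -> K^o} := fun phi => `[< linear phi >].

Fact linear_form_submod : submod_closed linear_form.
Proof.
split=> [|a phi psi /asboolP lphi /asboolP lpsi]; apply/asboolP => b u v.
  by rewrite scaler0 addr0.
have E (w : V) : (a *: phi + psi) w = a *: phi w + psi w by [].
by rewrite !E lphi lpsi !scalerDr !scalerA [a * b]mulrC addrACA.
Qed.
HB.instance Definition _ :=
  GRing.isSubmodClosed.Build K (V -> K^o) linear_form linear_form_submod.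

Record dual := Dual { dual_fun :> V -> K^o; _ : dual_fun \in linear_form }.
HB.instance Definition _ := [isSub for dual_fun].
HB.instance Definition _ := [Choice of dual by <:].
HB.instance Definition _ := [SubChoice_isSubLmodule of dual by <:].

Lemma dualP (phi psi : dual) : phi =1 psi -> phi = psi.
Proof. by move=> eq_fun; apply/val_inj/funext. Qed.

Lemma dual_linear (phi : dual) : linear phi.
Proof. by case: phi => f lf; exact/asboolP. Qed.
HB.instance Definition _ (phi : dual) :=
  GRing.isLinear.Build K V K^o _ (dual_fun phi) (dual_linear phi).

End Dual.

Section RationalSchur.
Variables (K : fieldType) (n : nat).

(* K-points of GL(n); regular functions on GL(n) are viewed as functions on
   K-points, which loses nothing when K is infinite. *)
Definition GLpt : Type := {g : 'M[K]_n | g \in unitmx}.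

Definition GL1 : GLpt :=
  @exist 'M[K]_n (fun g => g \in unitmx) 1%:M (unitmx1 K n).

Fact GLmul_subproof (g h : GLpt) : val g *m val h \in unitmx.
Proof. by rewrite unitmx_mul (valP g) (valP h). Qed.
Definition GLmul (g h : GLpt) : GLpt :=
  @exist 'M[K]_n (fun g => g \in unitmx) _ (GLmul_subproof g h).

Definition coord_c (i j : 'I_n) : GLpt -> K^o := fun g => val g i j.
Definition coord_d (i j : 'I_n) : GLpt -> K^o := fun g => invmx (val g) i j.

Definition exp_total (a : 'M[nat]_n) : nat := (\sum_i \sum_j a i j)%N.

Definition rat_monomial (a b : 'M[nat]_n) : GLpt -> K^o := fun g =>
  (\prod_i \prod_j coord_c i j g ^+ a i j)
  * (\prod_i \prod_j coord_d i j g ^+ b i j).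

Inductive is_rat_monomial (r s : nat) : (GLpt -> K^o) -> Prop :=
| IsRatMonomial a b : exp_total a = r -> exp_total b = s ->
    is_rat_monomial r s (rat_monomial a b).

Definition in_rat_coef (r s : nat) : {pred GLpt -> K^o} :=
  fun f => `[< lin_span (is_rat_monomial r s) f >].

Fact in_rat_coef_submod r s : submod_closed (in_rat_coef r s).
Proof.
split=> [|a u v /asboolP Au /asboolP Av]; apply/asboolP; first exact: span_0.
by apply: span_D => //; exact: span_Z.
Qed.
HB.instance Definition _ r s :=
  GRing.isSubmodClosed.Build K (GLpt -> K^o) (in_rat_coef r s)
    (in_rat_coef_submod r s).

(* A(n,r,s) *)
Record rat_coef (r s : nat) :=
  RatCoef { rat_fun :> GLpt -> K^o; _ : rat_fun \in in_rat_coef r s }.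
HB.instance Definition _ r s := [isSub for @rat_fun r s].
HB.instance Definition _ r s := [Choice of rat_coef r s by <:].
HB.instance Definition _ r s := [SubChoice_isSubLmodule of rat_coef r s by <:].

Lemma rat_coefP r s (f g : rat_coef r s) : f =1 g -> f = g.
Proof. by move=> eq_fun; apply/val_inj/funext. Qed.

Lemma rat_monomialM a b a' b' g :
  rat_monomial a b g * rat_monomial a' b' g = rat_monomial (a + a') (b + b') g.
Proof.
rewrite /rat_monomial mulrACA; congr (_ * _); rewrite -big_split;
  apply: eq_bigr => i _; rewrite -big_split; apply: eq_bigr => j _;
  by rewrite mxE; exact/esym/exprD.
Qed.

Lemma exp_totalD a b : exp_total (a + b) = (exp_total a + exp_total b)%N.
Proof.
rewrite /exp_total -big_split; apply: eq_bigr => i _.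
by rewrite -big_split; apply: eq_bigr => j _; rewrite mxE.
Qed.

Lemma rat_coefM_subproof r s r' s' (f : rat_coef r s) (f' : rat_coef r' s') :
  (fun g => f g * f' g : K^o) \in in_rat_coef (r + r') (s + s').
Proof.
case: f f' => [f /= /asboolP Af] [f' /= /asboolP Af']; apply/asboolP.
elim: Af => [_ [a b ra sb]||u v _ IHu _ IHv|k v _ IHv].
- elim: Af' => [_ [a' b' ra' sb']||u v _ IHu _ IHv|k v _ IHv].
  + rewrite (_ : (fun g => _) = rat_monomial (a + a') (b + b')).
      by apply/span_gen; split; rewrite exp_totalD ?(ra, sb, ra', sb').
    by apply/funext => g; rewrite rat_monomialM.
  + rewrite (_ : (fun g => _) = 0); first exact: span_0.
    by apply/funext => g; rewrite mulr0.
  + have := span_D IHu IHv; congr (lin_span _ _).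
    by apply/funext => g; rewrite mulrDr.
  + have := span_Z k IHv; congr (lin_span _ _).
    by apply/funext => g; rewrite /= mulrCA.
- rewrite (_ : (fun g => _) = 0); first exact: span_0.
  by apply/funext => g; rewrite mul0r.
- have := span_D IHu IHv; congr (lin_span _ _).
  by apply/funext => g; rewrite mulrDl.
- have := span_Z k IHv; congr (lin_span _ _).
  by apply/funext => g; rewrite /= -mulrA.
Qed.
Definition rat_coefM r s r' s' (f : rat_coef r s) (f' : rat_coef r' s') :=
  RatCoef (rat_coefM_subproof f f').

Lemma rat_monomial_c i j : rat_monomial (delta_mx i j) 0 = coord_c i j.
Proof.
apply/funext => g; rewrite /rat_monomial [X in _ * X]big1 => [|k _]; last first.
  by apply: big1 => l _; rewrite mxE.
rewrite mulr1 (bigD1 i) //= (bigD1 j) //= mxE !eqxx expr1.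
rewrite big1 => [|l /negPf lj]; last by rewrite mxE lj andbF.
rewrite big1 ?mulr1 // => k /negPf ki.
by apply: big1 => l _; rewrite mxE ki.
Qed.

Lemma rat_monomial_d i j : rat_monomial 0 (delta_mx i j) = coord_d i j.
Proof.
apply/funext => g; rewrite /rat_monomial [X in X * _]big1 => [|k _]; last first.
  by apply: big1 => l _; rewrite mxE.
rewrite mul1r (bigD1 i) //= (bigD1 j) //= mxE !eqxx expr1.
rewrite big1 => [|l /negPf lj]; last by rewrite mxE lj andbF.
rewrite big1 ?mulr1 // => k /negPf ki.
by apply: big1 => l _; rewrite mxE ki.
Qed.

Lemma exp_total0 : exp_total 0 = 0%N.
Proof. by rewrite /exp_total !big1 // => i _; rewrite big1 // => j _; rewrite mxE. Qed.

Lemma exp_total_delta i j : exp_total (delta_mx i j) = 1%N.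
Proof.
rewrite /exp_total (bigD1 i) //= (bigD1 j) //= mxE !eqxx.
rewrite big1 => [|l /negPf lj]; last by rewrite mxE lj andbF.
rewrite big1 // => k /negPf ki.
by apply: big1 => l _; rewrite mxE ki.
Qed.

Lemma coord_c_subproof i j : coord_c i j \in in_rat_coef 1 0.
Proof.
apply/asboolP; rewrite -rat_monomial_c; apply: span_gen.
by split; rewrite ?exp_total0 ?exp_total_delta.
Qed.
Lemma coord_d_subproof i j : coord_d i j \in in_rat_coef 0 1.
Proof.
apply/asboolP; rewrite -rat_monomial_d; apply: span_gen.
by split; rewrite ?exp_total0 ?exp_total_delta.
Qed.
Lemma rat_coef1_subproof : (fun=> 1 : K^o) \in in_rat_coef 0 0.
Proof.
apply/asboolP; rewrite (_ : (fun=> 1) = rat_monomial 0 0).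
  by apply: span_gen; split; rewrite exp_total0.
apply/funext => g; rewrite /rat_monomial !big1 ?mulr1 // => i _;
by rewrite big1 // => j _; rewrite mxE.
Qed.

(* [is_comult f l]: Delta(f), i.e. the function (g, h) |-> f (g h), is the
   tensor sum of the p.1 (x) p.2, for p in l. *)
Definition is_comult r s (f : GLpt -> K^o) (l : seq (rat_coef r s * rat_coef r s)) :=
  forall g h : GLpt, f (GLmul g h) = \sum_(p <- l) p.1 g * p.2 h.

Definition comultiplicable r s f := exists l, @is_comult r s f l.

Lemma comultiplicableM r s r' s' f f' :
  comultiplicable r s f -> comultiplicable r' s' f' ->
  comultiplicable (r + r') (s + s') (fun g => f g * f' g).
Proof.
move=> [l fl] [l' fl'].
exists [seq (rat_coefM p.1 q.1, rat_coefM p.2 q.2) | p <- l, q <- l'] => g h.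
rewrite fl fl' big_allpairs_dep big_distrl; apply: eq_bigr => p _.
by rewrite big_distrr; apply: eq_bigr => q _; rewrite /= mulrACA.
Qed.

Lemma comultiplicable1 : comultiplicable 0 0 (fun=> 1).
Proof.
by exists [:: (RatCoef rat_coef1_subproof, RatCoef rat_coef1_subproof)] => g h;
  rewrite big_seq1 /= mulr1.
Qed.

Lemma comultiplicable_c i j : comultiplicable 1 0 (coord_c i j).
Proof.
exists [seq (RatCoef (coord_c_subproof i k), RatCoef (coord_c_subproof k j))
       | k <- enum 'I_n] => g h.
by rewrite big_map big_enum [LHS]mxE.
Qed.

Lemma comultiplicable_d i j : comultiplicable 0 1 (coord_d i j).
Proof.
exists [seq (RatCoef (coord_d_subproof k j), RatCoef (coord_d_subproof i k))
       | k <- enum 'I_n] => g h.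
rewrite big_map big_enum /coord_d /=.
have -> : invmx (val g *m val h) = invmx (val h) *m invmx (val g).
  have gh := GLmul_subproof g h; have [gU hU] := (valP g, valP h).
  apply: (can_inj (mulKmx gh)); rewrite mulmxV // !mulmxA.
  by rewrite -(mulmxA (val g)) mulmxV // mulmx1 mulmxV.
by rewrite mxE; apply: eq_bigr => k _; rewrite mulrC.
Qed.

Lemma comultiplicable_prod (I : Type) (e : seq I) (k l : I -> nat) F :
  (forall i, comultiplicable (k i) (l i) (F i)) ->
  comultiplicable (\sum_(i <- e) k i) (\sum_(i <- e) l i)
                  (fun g => \prod_(i <- e) F i g).
Proof.
move=> cF; elim: e => [|i e IHe].
  rewrite !big_nil (_ : (fun g => _) = fun=> 1); first exact: comultiplicable1.
  by apply/funext => g; rewrite big_nil.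
rewrite !big_cons (_ : (fun g => _) = fun g => F i g * \prod_(j <- e) F j g).
  exact: comultiplicableM.
by apply/funext => g; rewrite big_cons.
Qed.

Lemma comultiplicable_monomial a b :
  comultiplicable (exp_total a) (exp_total b) (rat_monomial a b).
Proof.
have cX i j k : comultiplicable k 0 (fun g => coord_c i j g ^+ k).
  elim: k => [|k IHk]; first exact: comultiplicable1.
  have := comultiplicableM (comultiplicable_c i j) IHk.
  by congr (comultiplicable _ _ _); apply/funext => g; rewrite exprS.
have dX i j k : comultiplicable 0 k (fun g => coord_d i j g ^+ k).
  elim: k => [|k IHk]; first exact: comultiplicable1.
  have := comultiplicableM (comultiplicable_d i j) IHk.
  by congr (comultiplicable _ _ _); apply/funext => g; rewrite exprS.
have -> : exp_total a = (exp_total a + \sum_(i < n) \sum_(j < n) 0)%N.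
  by rewrite big1 ?addn0 // => i _; rewrite big1.
have -> : exp_total b = (\sum_(i < n) \sum_(j < n) 0 + exp_total b)%N.
  by rewrite big1 // => i _; rewrite big1.
by apply: comultiplicableM; do 2![apply: comultiplicable_prod => ?].
Qed.

Lemma rat_coef_comult r s (f : rat_coef r s) : exists l, @is_comult r s f l.
Proof.
case: f => f /= /asboolP; elim=> [_ [a b <- <-]||u v _ [l ul] _ [m vm]|k v _ [l vl]].
- exact: comultiplicable_monomial.
- by exists [::] => g h; rewrite big_nil.
- by exists (l ++ m) => g h; rewrite big_cat -ul -vm.
- exists [seq (k *: p.1, p.2) | p <- l] => g h.
  rewrite big_map; have -> : (k *: v) (GLmul g h) = k * v (GLmul g h) by [].
  by rewrite vl big_distrr; apply: eq_bigr => p _; rewrite /= mulrA.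
Qed.

Lemma rat_translate_subproof r s (f : rat_coef r s) (g : GLpt) :
  (fun h => f (GLmul g h)) \in in_rat_coef r s.
Proof.
have [l fl] := rat_coef_comult f.
rewrite (_ : (fun h => _) = \sum_(p <- l) p.1 g *: rat_fun p.2).
  by apply: rpred_sum => p _; apply: rpredZ; exact: (valP p.2).
by apply/funext => h; rewrite fl fct_sumE.
Qed.
Definition rat_translate r s (f : rat_coef r s) g : rat_coef r s :=
  RatCoef (rat_translate_subproof f g).

Lemma rat_fun_sum r s (I : Type) (e : seq I) (F : I -> rat_coef r s) g :
  (\sum_(i <- e) F i) g = \sum_(i <- e) F i g.
Proof. by elim/big_rec2: _ => //= i x y _ <-. Qed.

Lemma rat_translateE r s (f : rat_coef r s) l g : is_comult f l ->
  rat_translate f g = \sum_(p <- l) p.1 g *: p.2.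
Proof. by move=> fl; apply: rat_coefP => h; rewrite rat_fun_sum /= fl. Qed.

Lemma rat_slice_subproof r s (psi : dual (rat_coef r s)) (f : rat_coef r s) :
  (fun g => psi (rat_translate f g)) \in in_rat_coef r s.
Proof.
have [l fl] := rat_coef_comult f.
rewrite (_ : (fun g => _) = \sum_(p <- l) psi p.2 *: rat_fun p.1).
  by apply: rpred_sum => p _; apply: rpredZ; exact: (valP p.1).
apply/funext => g; rewrite (rat_translateE g fl) linear_sum fct_sumE.
by apply: eq_bigr => p _; rewrite linearZ /= [LHS]mulrC.
Qed.
(* (id (x) psi) (Delta f) *)
Definition rat_slice r s (psi : dual (rat_coef r s)) (f : rat_coef r s) :
  rat_coef r s := RatCoef (rat_slice_subproof psi f).

(* The rational Schur algebra: the dual algebra of A(n,r,s), with the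
   convolution product phi * psi = (phi (x) psi) o Delta (see
   [rat_schur_mulE]) and the counit f |-> f 1 as unit. *)
Definition rat_schur (r s : nat) : Type := dual (rat_coef r s).
HB.instance Definition _ r s := GRing.Lmodule.on (rat_schur r s).

Section Algebra.
Variables r s : nat.
Local Notation A := (rat_coef r s).
Local Notation S := (rat_schur r s).
Implicit Types phi psi chi : S.

Fact schur_mul_subproof phi psi :
  (fun f : A => phi (rat_slice psi f)) \in @linear_form K A.
Proof.
apply/asboolP => a f f'; rewrite -linearP; congr (phi _).
apply: rat_coefP => g /=; rewrite -[RHS]linearP; congr (psi _).
exact: rat_coefP.
Qed.
Definition schur_mul phi psi : S := Dual (schur_mul_subproof phi psi).

Fact schur_one_subproof : (fun f : A => f GL1) \in @linear_form K A.
Proof. by apply/asboolP. Qed.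
Definition schur_one : S := Dual schur_one_subproof.

Fact GLmulA : associative GLmul.
Proof. by move=> g h k; apply: val_inj; rewrite /= mulmxA. Qed.
Fact GLmul1 g : GLmul g GL1 = g.
Proof. by apply: val_inj; rewrite /= mulmx1. Qed.
Fact GL1mul g : GLmul GL1 g = g.
Proof. by apply: val_inj; rewrite /= mul1mx. Qed.

Fact schur_mulA : associative schur_mul.
Proof.
move=> phi psi chi; apply: dualP => f /=; congr (phi _).
apply: rat_coefP => g /=; congr (psi _); apply: rat_coefP => h /=.
by congr (chi _); apply: rat_coefP => k /=; rewrite GLmulA.
Qed.
Fact schur_mul1r : left_id schur_one schur_mul.
Proof.
move=> phi; apply: dualP => f /=; congr (phi _).
by apply: rat_coefP => g /=; rewrite GL1mul.
Qed.
Fact schur_mulr1 : right_id schur_one schur_mul.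
Proof.
move=> phi; apply: dualP => f /=; congr (phi _).
by apply: rat_coefP => g /=; rewrite GLmul1.
Qed.
Fact schur_mulDl : left_distributive schur_mul +%R.
Proof. by move=> phi psi chi; apply: dualP. Qed.
Fact schur_mulDr : right_distributive schur_mul +%R.
Proof.
move=> phi psi chi; apply: dualP => f /=.
by rewrite -[RHS]linearD; congr (phi _); exact: rat_coefP.
Qed.

HB.instance Definition _ := GRing.Zmodule_isPzRing.Build S
  schur_mulA schur_mul1r schur_mulr1 schur_mulDl schur_mulDr.

Lemma rat_schur_mulE phi psi (f : A) l : is_comult f l ->
  (phi * psi) f = \sum_(p <- l) phi p.1 * psi p.2.
Proof.
move=> fl; have -> : (phi * psi) f = phi (rat_slice psi f) by [].
have -> : rat_slice psi f = \sum_(p <- l) psi p.2 *: p.1.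
  apply: rat_coefP => g; rewrite /= (rat_translateE g fl) linear_sum rat_fun_sum.
  by apply: eq_bigr => p _; rewrite linearZ [LHS]mulrC.
rewrite linear_sum; apply: eq_bigr => p _; rewrite linearZ; exact: mulrC.
Qed.

Lemma rat_schur_scaleAl (k : K) (phi psi : S) : k *: (phi * psi) = (k *: phi) * psi.
Proof. by apply: dualP. Qed.

Lemma rat_schur_scaleAr (k : K) (phi psi : S) : k *: (phi * psi) = phi * (k *: psi).
Proof.
apply: dualP => f; apply: esym.
have -> : (phi * (k *: psi)) f = phi (k *: rat_slice psi f).
  by congr (phi _); exact: rat_coefP.
by rewrite linearZ.
Qed.

Lemma rat_schur_oneE (f : A) : (1 : S) f = f GL1. Proof. by []. Qed.

End Algebra.

(* The derivative at the identity in the direction X of a monomial, i.e. the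
   coefficient of t in its value at 1 + t X over K[t]/(t^2), where
   (1 + t X)^-1 = 1 - t X. *)
Definition tangent_monomial (X : 'M[K]_n) (a b : 'M[nat]_n) : K :=
  let c i j : {poly K} := ((i == j)%:R)%:P + X i j *: 'X in
  let d i j : {poly K} := ((i == j)%:R)%:P - X i j *: 'X in
  ((\prod_i \prod_j c i j ^+ a i j) * (\prod_i \prod_j d i j ^+ b i j))`_1.

End RationalSchur.

(* Main.v *)
Require Import Defs.
From HB Require Import structures.
From mathcomp Require Import all_boot all_order all_algebra.
From mathcomp Require Import boolp functions finmap monalg.
From mathcomp Require Import perm ring zify.
Set Implicit Arguments.
Unset Strict Implicit.
Unset Printing Implicit Defensive.
Import Order.TTheory GRing.Theory Num.Theory.
Local Open Scope ring_scope.

(** Why the theorem is true.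

Let Q be the quotient of U(gl_n) by the relations, and A the coefficient space
A(n,r,s). The Lie algebra acts on A by left-invariant derivations: X f is the
derivative of f (g (1 + t X)) at t = 0. The map u |-> (f |-> (u f)(1)) is then an
algebra morphism from U(gl_n) to the convolution algebra A^*, which sends X to the
tangent functional. A monomial in the c_ij and d_ij is an eigenvector of every H_S,
with an eigenvalue in [-s, r], and of the sum of all H_i, with eigenvalue r - s.
Hence the relations act by zero, and the morphism factors through Q.

Surjectivity: as A is finite-dimensional, it suffices that a function f in A with
(u f)(1) = 0 for all u is zero. In characteristic zero this is Taylor expansion along
the lines 1 + t X; clearing the denominators det (1 + t X) makes it a statement about
polynomials in t that satisfy a linear differential system ([line_ode],
[eval_vanish]).

Injectivity is complete reducibility, in the little amount needed. The relations bound
the weights of every Q-module, so highest weight vectors exist ([highest_ex]) and have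
dominant weights ([highest_dominant]). The Casimir element is central, and its value on
highest weight vectors is strictly increasing along the dominance order of dominant
weights ([casimir_value_lt]). It follows that a vector of dominant weight is the sum of
a highest weight vector and an element of n^- V ([weight_split]).

Suppose that the kernel is nonzero. It is a bimodule, so it contains y <> 0 which is a
highest weight vector on the left and, after transposition, on the right, say of
weight mu on the right. Splitting the idempotent of weight mu in Q yields a highest
weight vector z of weight mu with y z = y. The weight mu is dominant and bounded by the
relations, and for such mu the space A contains a nonzero highest weight vector f of
weight mu, a product of corner minors of g and of its inverse ([highest_function]). Now
y sends (z, f) to (y, 0), as y acts by zero on A. By the Casimir element, every highest
weight vector in the submodule of Q * A generated by (z, f) is a multiple of (z, f).
Since f <> 0, this forces y = 0 ([kernel_trivial]). *)

(** * Integers in characteristic zero, linear maps on matrices *)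

Section CharZero.
Variables (K : fieldType).
Hypothesis charK0 : [pchar K] =i pred0.

Lemma natr_eq0_char0 m : (m%:R == 0 :> K) = (m == 0)%N.
Proof. by have /pcharf0P := charK0. Qed.

Lemma intr_eq0_char0 (m : int) : (m%:~R == 0 :> K) = (m == 0).
Proof. by case: m => m; rewrite ?NegzE ?mulrNz ?oppr_eq0 natr_eq0_char0. Qed.

Lemma intr_inj_char0 : injective (fun m : int => m%:~R : K).
Proof.
move=> x y /eqP; rewrite -subr_eq0 -mulrzBr intr_eq0_char0 subr_eq0.
by move/eqP.
Qed.
End CharZero.

Section LinearMatrix.
Variables (K : fieldType) (n : nat) (V : lmodType K) (F : 'M[K]_n -> V).
Hypothesis linF : linear F.
HB.instance Definition _ := GRing.isLinear.Build K 'M[K]_n V *:%R F linF.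

Lemma linear_matrix X : F X = \sum_i \sum_j X i j *: F (delta_mx i j).
Proof.
rewrite {1}[X]matrix_sum_delta linear_sum; apply: eq_bigr => i _.
by rewrite linear_sum; apply: eq_bigr => j _; rewrite linearZ.
Qed.
End LinearMatrix.

(** * Weights of the diagonal torus and the dominance order *)

Section Weights.
Variable n : nat.
Implicit Types (mu nu lam : 'I_n -> int) (i j k : 'I_n).

Definition dominant nu := forall i j, (i <= j)%N -> nu j <= nu i.
Definition pairing nu mu : int := \sum_i nu i * mu i.
Definition add_root mu i j : 'I_n -> int := fun k => mu k + (k == i)%:Z - (k == j)%:Z.
(** The sum of the positive roots e_k - e_l, k < l. *)
Definition two_rho i : int := n%:Z - 1 - 2 * (i : nat)%:Z.
Definition height mu : int := pairing two_rho mu.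
(** The dominance order (lam - mu lies in the cone of the positive roots), encoded
by its dual cone: this makes stability under adding roots immediate, and the
instances nu = mu + lam and nu = two_rho are what the Casimir estimate uses. *)
Definition weight_le mu lam :=
  forall nu, dominant nu -> pairing nu mu <= pairing nu lam.
(** (mu, mu + 2 rho), the scalar by which the Casimir element acts on a highest
weight vector. *)
Definition casimir_value mu : int := \sum_i mu i * mu i + height mu.

Lemma two_rho_dominant : dominant two_rho.
Proof. by move=> i j ij; rewrite /two_rho; lia. Qed.

Lemma pairing_add_root nu mu i j :
  pairing nu (add_root mu i j) = pairing nu mu + (nu i - nu j).
Proof.
have pick k : \sum_l nu l * (l == k)%:Z = nu k.
  rewrite (bigD1 k) //= eqxx mulr1 big1 ?addr0 // => l /negPf ->.
  by rewrite mulr0.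
rewrite /pairing /add_root -[in RHS](pick i) -[in RHS](pick j).
by rewrite -sumrB -big_split; apply: eq_bigr => k _ /=; ring.
Qed.

Lemma height_add_root mu i j :
  height (add_root mu i j) = height mu + 2 * ((j : nat)%:Z - (i : nat)%:Z).
Proof. by rewrite /height pairing_add_root /two_rho; ring. Qed.

Lemma weight_le_add_root mu lam i j : (i < j)%N ->
  weight_le mu lam -> weight_le mu (add_root lam i j).
Proof.
move=> ij le_mu nu dnu; rewrite pairing_add_root.
by rewrite (le_trans (le_mu _ dnu)) // lerDl subr_ge0 dnu // ltnW.
Qed.

Lemma weight_le_sub_root mu lam i j : (i < j)%N ->
  weight_le mu lam -> weight_le (add_root mu j i) lam.
Proof.
move=> ij le_mu nu dnu; rewrite pairing_add_root.
by rewrite (le_trans _ (le_mu _ dnu)) // gerDl subr_le0 dnu // ltnW.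
Qed.

(** The index i comes first in n - 1 - i pairs and second in i pairs, hence the
coefficient n - 1 - 2 i of [two_rho]. *)
Lemma height_pairs mu : \sum_(i < n) \sum_(j < n | (i < j)%N) (mu i - mu j) = height mu.
Proof.
have low (i : 'I_n) : \sum_(j < n | (j < i)%N) 1%N = i.
  by rewrite -(big_ord_widen n (fun=> 1%N)) ?sum1_card ?card_ord // ltnW.
have low1 (i : 'I_n) : \sum_(j < n | (j < i.+1)%N) 1%N = i.+1.
  by rewrite -(big_ord_widen n (fun=> 1%N)) ?sum1_card ?card_ord.
have up (i : 'I_n) : \sum_(j < n | (i < j)%N) 1%N = (n - i.+1)%N.
  have : (\sum_(j < n) 1 = n)%N by rewrite sum1_card card_ord.
  rewrite (bigID (fun j : 'I_n => (j < i.+1)%N)) /= low1.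
  under eq_bigl => j do rewrite -leqNgt.
  by move=> sumE; apply/(can_inj (addnK i.+1)); rewrite subnK // addnC.
under eq_bigr => i _ do rewrite big_split /= sumr_const.
rewrite big_split /= [X in _ + X](exchange_big_dep predT) //= -big_split.
apply: eq_bigr => i _; rewrite sumr_const /= -!sum1_card low up /two_rho.
rewrite mulNrn -[mu i *+ (n - _)]mulr_natr -[mu i *+ i]mulr_natr !natz.
rewrite -subzn ?ltn_ord //.
by rewrite -addn1 PoszD; ring.
Qed.

(** With delta = lam - mu, the difference of the two values is
(mu + lam, delta) + (2 rho, delta); the first pairing is nonnegative because
mu + lam is dominant, the second one is the difference of heights. *)
Lemma casimir_value_lt mu lam : dominant mu -> dominant lam ->
  weight_le mu lam -> height mu < height lam ->
  casimir_value mu < casimir_value lam.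
Proof.
move=> dmu dlam mulam hlt; rewrite /casimir_value.
have dom : dominant (fun i => mu i + lam i).
  by move=> i j ij; rewrite lerD ?dmu ?dlam.
have := mulam _ dom; rewrite /pairing => le.
apply: ler_ltD hlt.
rewrite -subr_ge0 -sumrB.
rewrite -subr_ge0 -sumrB in le; apply: le_trans le _.
by rewrite le_eqVlt; apply/orP; left; apply/eqP/eq_bigr => i _; ring.
Qed.

(** Bounded weights have bounded height, so raising a weight stops: this is the
termination measure of [highest_ind]. *)
Lemma height_le_bound mu (r s : nat) :
  (forall i, - s%:Z <= mu i <= r%:Z) -> height mu <= (n * (n * (r + s)))%:Z.
Proof.
move=> mu_rs; have le i : two_rho i * mu i <= (n * (r + s))%:Z.
  have := mu_rs i; rewrite /two_rho; have := ltn_ord i; nia.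
rewrite /height /pairing; apply: le_trans (ler_sum _ (fun i _ => le i)) _.
by rewrite sumr_const card_ord -[(_ *+ _ : int)]pmulrn; lia.
Qed.

End Weights.

(** * Split polynomials in an operator *)

Section Shifts.
Variables (K : fieldType) (V : lmodType K) (T : V -> V).
Hypothesis linT : linear T.
HB.instance Definition _ := GRing.isLinear.Build K V V *:%R T linT.

(** The operator \prod_(l <- ls) (T - l). *)
Definition shifts (ls : seq K) (v : V) := foldr (fun l u => T u - l *: u) v ls.

Lemma shifts_linear ls : linear (shifts ls).
Proof.
elim: ls => [|l ls IH] a u v //=.
by rewrite IH linearP !scalerDr scalerN opprD addrACA !scalerA [l * a]mulrC.
Qed.

Lemma shifts0 ls : shifts ls 0 = 0.
Proof. by elim: ls => //= l ls ->; rewrite linear0 scaler0 subrr. Qed.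

Lemma shifts_cat ls1 ls2 v : shifts (ls1 ++ ls2) v = shifts ls1 (shifts ls2 v).
Proof. exact: foldr_cat. Qed.

Lemma shifts_comm (T' : V -> V) ls v : linear T' ->
  (forall u, T (T' u) = T' (T u)) -> shifts ls (T' v) = T' (shifts ls v).
Proof.
move=> linT' TT'; elim: ls => //= l ls ->.
by rewrite TT' addrC -scaleNr -linT' scaleNr addrC.
Qed.

Lemma shiftsC ls1 ls2 v : shifts ls1 (shifts ls2 v) = shifts ls2 (shifts ls1 v).
Proof.
apply: shifts_comm; first exact: shifts_linear.
move=> u; apply/esym/shifts_comm => //; exact: linT.
Qed.

Lemma shifts_rot m ls1 ls2 v :
  T (shifts (ls1 ++ ls2) v) - m *: shifts (ls1 ++ ls2) v = shifts (ls1 ++ m :: ls2) v.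
Proof.
by rewrite -[LHS]/(shifts [:: m] (shifts (ls1 ++ ls2) v)) !shifts_cat shiftsC.
Qed.

Lemma shifts_eigen m ls v : T v = m *: v ->
  shifts ls v = (\prod_(l <- ls) (m - l)) *: v.
Proof.
move=> Tv; elim: ls => [|l ls IH] /=; first by rewrite big_nil scale1r.
by rewrite IH big_cons linearZ /= Tv !scalerA -scalerBl mulrBl [_ * m]mulrC.
Qed.

Lemma eigen_mem m ls v : T v = m *: v -> shifts ls v = 0 -> v != 0 -> m \in ls.
Proof.
move=> /shifts_eigen -> /eqP; rewrite scaler_eq0 => /orP [|/eqP-> /eqP//].
by rewrite prodf_seq_eq0 => /hasP [l lsl]; rewrite subr_eq0 => /= /eqP -> _.
Qed.

(** Among the partial products of \prod_l (T - l) applied to v, the last nonzero one is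
an eigenvector; C is any property that these products keep. *)
Lemma eigen_ex (C : V -> Prop) ls v :
  (forall l u, C u -> C (T u - l *: u)) -> C v -> v != 0 ->
  shifts ls v = 0 -> exists l u, [/\ l \in ls, C u, u != 0 & T u = l *: u].
Proof.
move=> CT; elim: ls v => [|l ls IH] v Cv v0 /=; first by move=> /eqP; rewrite (negPf v0).
have [sv|sv] := eqVneq (shifts ls v) 0.
  have [k [u [ku Cu u0 uk]]] := IH v Cv v0 sv.
  by exists k, u; split=> //; rewrite inE ku orbT.
move=> /eqP; rewrite subr_eq0 => /eqP E; exists l, (shifts ls v).
split=> //; first by rewrite mem_head.
by elim: {IH sv E} ls => //= k ls IH; apply: CT.
Qed.

(** Eigenvectors for distinct eigenvalues are independent: \prod (T - l) over the
eigenvalues that occur in a decomposition of v kills v, and acts on it by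
\prod (m - l). *)
Lemma eigen_span (P : K -> Prop) m v :
  lin_span (fun u => exists2 l, P l & T u = l *: u) v ->
  T v = m *: v -> v != 0 -> P m.
Proof.
move=> spv Tv v0.
have [ls lsP lsv] : exists2 ls, (forall l, l \in ls -> P l) & shifts ls v = 0.
  elim: spv => [u [l Pl Tu]||u w _ [ls1 P1 s1] _ [ls2 P2 s2]|a w _ [ls P1 s1]].
  - by exists [:: l] => [k|]; [rewrite inE => /eqP-> | rewrite /= Tu subrr].
  - by exists [::].
  - exists (ls1 ++ ls2) => [l|]; first by rewrite mem_cat => /orP [/P1|/P2].
    rewrite -[u]scale1r shifts_linear scale1r.
    by rewrite !shifts_cat s2 shiftsC s1 !shifts0 addr0.
  - by exists ls => //; rewrite -[_ *: _]addr0 shifts_linear s1 scaler0 shifts0 addr0.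
by apply: lsP; apply: eigen_mem lsv v0.
Qed.

End Shifts.

Lemma eq_shifts (K : fieldType) (V : lmodType K) (T T' : V -> V) ls v :
  T =1 T' -> shifts T ls v = shifts T' ls v.
Proof. by move=> eqT; elim: ls => //= l ls ->; rewrite eqT. Qed.

(** * Highest weight theory for bounded gl_n-modules *)

Section GlModules.
Variables (K : fieldType) (n : nat).
Hypothesis charK0 : [pchar K] =i pred0.
Local Notation E := (@delta_mx K n n).

(** The element H_S of gl_n. *)
Definition unit_sum (S : {set 'I_n}) : 'M[K]_n := \sum_(i in S) E i i.

Record gl_module (V : lmodType K) (rho : 'M[K]_n -> V -> V) : Prop := {
  gl_linX : forall v, linear (rho^~ v);
  gl_linV : forall X, linear (rho X);
  gl_bracket : forall X Y v,
    rho (X *m Y - Y *m X) v = rho X (rho Y v) - rho Y (rho X v) }.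

(** The relations on the H_S seen on a module. The finite set L of allowed eigenvalues
of H_S is left open, as the ideal imposes the interval [-s, r] for proper S and
the single value r - s for the full set; distinctness of its elements makes H_S
diagonalizable. *)
Definition rational_module (r s : nat) (V : lmodType K) (rho : 'M[K]_n -> V -> V) : Prop :=
  forall S : {set 'I_n}, exists2 L : seq int,
    uniq L /\ {in L, forall l, - s%:Z <= l <= r%:Z} &
    forall v, shifts (rho (unit_sum S)) [seq l%:~R | l <- L] v = 0.

Section Module.
Variables (V : lmodType K) (rho : 'M[K]_n -> V -> V).
Hypothesis mod : gl_module rho.
Implicit Types (v u w : V) (X Y : 'M[K]_n) (mu nu lam : 'I_n -> int).

HB.instance Definition _ X := GRing.isLinear.Build K V V *:%R (rho X) (gl_linV mod X).
Let at_vector v X := rho X v.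
HB.instance Definition _ v :=
  GRing.isLinear.Build K 'M[K]_n V *:%R (at_vector v) (gl_linX mod v).

Lemma rhoZ a X v : rho (a *: X) v = a *: rho X v.
Proof. exact: (linearZZ (at_vector v)). Qed.
Lemma rho_sum I (e : seq I) P F v :
  rho (\sum_(i <- e | P i) F i) v = \sum_(i <- e | P i) rho (F i) v.
Proof. exact: (linear_sum (at_vector v)). Qed.
Lemma rho0 v : rho 0 v = 0.
Proof. exact: (linear0 (at_vector v)). Qed.
Lemma rhoB X Y v : rho (X - Y) v = rho X v - rho Y v.
Proof. exact: (linearB (at_vector v)). Qed.

Lemma rho_comm X Y v :
  rho X (rho Y v) = rho Y (rho X v) + rho (X *m Y - Y *m X) v.
Proof. by rewrite gl_bracket // addrC subrK. Qed.

Lemma rho_matrix X v : rho X v = \sum_i \sum_j X i j *: rho (E i j) v.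
Proof. exact: linear_matrix (gl_linX mod v) X. Qed.

Lemma delta_mulE i j k l : E i j *m E k l = (j == k)%:R *: E i l.
Proof. by rewrite mul_delta_mx_cond scaler_nat. Qed.

Definition weight mu v := forall i, rho (E i i) v = (mu i)%:~R *: v.
Definition highest v := forall i j : 'I_n, (i < j)%N -> rho (E i j) v = 0.

Lemma weight0 mu : weight mu 0.
Proof. by move=> i; rewrite linear0 scaler0. Qed.

Lemma weight_lin mu a u v : weight mu u -> weight mu v -> weight mu (a *: u + v).
Proof. by move=> wu wv i; rewrite linearP /= wu wv scalerDr !scalerA mulrC. Qed.

Lemma weight_diag mu v (d : 'I_n -> int) : weight mu v ->
  rho (\sum_i (d i)%:~R *: E i i) v = (pairing d mu)%:~R *: v.
Proof.
move=> wv; rewrite rho_sum /pairing rmorph_sum scaler_suml.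
by apply: eq_bigr => i _; rewrite rhoZ wv scalerA -intrM.
Qed.

Lemma weight_unit_sum mu v S : weight mu v ->
  rho (unit_sum S) v = (\sum_(i in S) mu i)%:~R *: v.
Proof.
move=> wv; rewrite rho_sum rmorph_sum scaler_suml.
by apply: eq_bigr => i _; rewrite wv.
Qed.

Lemma weight_root mu v i j : weight mu v -> weight (add_root mu i j) (rho (E i j) v).
Proof.
move=> wv k; rewrite rho_comm wv linearZ /= !delta_mulE (eq_sym j k).
rewrite /add_root; case: (eqVneq k i) => [->|_]; case: eqVneq => [->|_] /=.
- by rewrite subrr rho0 addr0 addrK.
- by rewrite scale1r scale0r subr0 subr0 intrD scalerDl scale1r.
- by rewrite scale1r scale0r addr0 rhoB rho0 sub0r intrB scalerBl scale1r.
- by rewrite !scale0r subrr rho0 addr0 addr0 subr0.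
Qed.

Section Casimir.
Definition casimir v := \sum_i \sum_j rho (E i j) (rho (E j i) v).

Lemma casimir_linear : linear casimir.
Proof.
move=> a u v; rewrite /casimir scaler_sumr -big_split; apply: eq_bigr => i _.
by rewrite scaler_sumr -big_split; apply: eq_bigr => j _; rewrite /= !linearP.
Qed.

HB.instance Definition _ := GRing.isLinear.Build K V V *:%R casimir casimir_linear.

(** Centrality of the Casimir element \sum_(i,j) e_ij e_ji: the four families of terms
of [e_kl, e_ij e_ji] cancel in pairs after summation. *)
Lemma casimirC X v : casimir (rho X v) = rho X (casimir v).
Proof.
suff comm k l : rho (E k l) (casimir v) = casimir (rho (E k l) v).
  rewrite [RHS]rho_matrix [in LHS]rho_matrix.
  rewrite linear_sum; apply: eq_bigr => k _.
  by rewrite linear_sum; apply: eq_bigr => l _; rewrite linearZ /= comm.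
have step i j : rho (E k l) (rho (E i j) (rho (E j i) v)) =
    rho (E i j) (rho (E j i) (rho (E k l) v))
    + ((l == i)%:R *: rho (E k j) (rho (E j i) v)
       - (j == k)%:R *: rho (E i l) (rho (E j i) v))
    + ((l == j)%:R *: rho (E i j) (rho (E k i) v)
       - (i == k)%:R *: rho (E i j) (rho (E j l) v)).
  rewrite rho_comm [rho (E k l) (rho (E j i) v)]rho_comm linearD /=.
  by rewrite !delta_mulE !rhoB !rhoZ linearB !linearZ /= addrAC.
have pick (F : 'I_n -> V) m : \sum_i (m == i)%:R *: F i = F m.
  rewrite (bigD1 m) //= eqxx scale1r big1 ?addr0 // => i.
  by rewrite eq_sym => /negPf->; rewrite scale0r.
have pick' (F : 'I_n -> V) m : \sum_i (i == m)%:R *: F i = F m.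
  by rewrite -[RHS]pick; apply: eq_bigr => i _; rewrite eq_sym.
rewrite /casimir linear_sum.
under eq_bigr => i _.
  rewrite linear_sum; under eq_bigr => j _ do rewrite /= step.
  rewrite !big_split /= !sumrN -!scaler_sumr !pick !pick'.
  over.
rewrite !big_split /= !sumrN pick pick' -!addrA.
rewrite [X in _ + X](_ : _ = 0) ?addr0 //.
by rewrite addKr subrr.
Qed.

(** Moving each raising operator to the right costs H_i - H_j: the Casimir element is
a scalar on a weight vector, up to terms e_ji e_ij with i < j. *)
Lemma casimir_weight mu v : weight mu v ->
  casimir v = (casimir_value mu)%:~R *: v
    + 2%:R *: \sum_(i < n) \sum_(j < n | (i < j)%N) rho (E j i) (rho (E i j) v).
Proof.
move=> wv; pose F i j := rho (E i j) (rho (E j i) v).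
have swap (i j : 'I_n) : (i < j)%N -> F i j = F j i + (mu i - mu j)%:~R *: v.
  move=> ij; rewrite /F rho_comm !delta_mulE !eqxx !scale1r rhoB !wv.
  by rewrite -scalerBl -intrB.
have diag i : F i i = (mu i * mu i)%:~R *: v.
  by rewrite /F wv linearZ /= wv scalerA intrM.
have split (i : 'I_n) : \sum_(j < n) F i j =
    F i i + (\sum_(j < n | (i < j)%N) F i j + \sum_(j < n | (j < i)%N) F i j).
  rewrite (bigD1 i) //= (bigID (fun j : 'I_n => (i < j)%N)) /=.
  congr (_ + (_ + _)); apply: eq_bigl => j; rewrite -val_eqE /=; lia.
rewrite /casimir (eq_bigr _ (fun i _ => split i)) !big_split /=.
rewrite [X in _ + (_ + X)](exchange_big_dep predT) //=.
rewrite [X in _ + (X + _)](_ : _ =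
    \sum_(i < n) \sum_(j < n | (i < j)%N) F j i + (height mu)%:~R *: v).
  rewrite (eq_bigr _ (fun i _ => diag i)) -scaler_suml -rmorph_sum /=.
  rewrite /casimir_value intrD scalerDl -[in RHS]addrA; congr (_ + _).
  by rewrite scaler_nat mulr2n [_ + _%:~R *: v]addrC -addrA.
rewrite -height_pairs rmorph_sum scaler_suml -big_split; apply: eq_bigr => i _ /=.
rewrite rmorph_sum scaler_suml -big_split; apply: eq_bigr => j ij /=.
exact: swap.
Qed.
End Casimir.

Lemma eq_weight mu nu v : mu =1 nu -> weight mu v -> weight nu v.
Proof. by move=> eq_mu wv i; rewrite -eq_mu. Qed.

Lemma highest0 : highest 0.
Proof. by move=> i j _; rewrite linear0. Qed.

Lemma highest_lin a u v : highest u -> highest v -> highest (a *: u + v).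
Proof. by move=> hu hv i j ij; rewrite linearP /= hu ?hv // scaler0 addr0. Qed.

Lemma casimir_highest mu v : weight mu v -> highest v ->
  casimir v = (casimir_value mu)%:~R *: v.
Proof.
move=> wv hv; rewrite (casimir_weight wv) [X in _ + _ *: X]big1 ?scaler0 ?addr0 //.
by move=> i _; rewrite big1 // => j ij; rewrite hv // linear0.
Qed.

Lemma shifts_casimirC ls X v :
  rho X (shifts casimir ls v) = shifts casimir ls (rho X v).
Proof.
by apply/esym/shifts_comm; [exact: gl_linV|move=> u; exact: casimirC].
Qed.

Lemma weight_shifts_casimir mu ls v : weight mu v -> weight mu (shifts casimir ls v).
Proof.
move=> wv i; rewrite shifts_casimirC wv -[_ *: v]addr0.
by rewrite (shifts_linear casimir_linear) (shifts0 casimir_linear) addr0.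
Qed.

(** The sl_2-computation e f^(k+1) v = (k+1) (h - k) f^k v for a highest vector v. *)
Lemma highest_sl2 mu v (i j : 'I_n) k : (i < j)%N -> weight mu v -> highest v ->
  rho (E i j) (iter k.+1 (rho (E j i)) v)
  = (k.+1%:Z * (mu i - mu j - k%:Z))%:~R *: iter k (rho (E j i)) v.
Proof.
move=> ij wv hv; set f := rho (E j i).
have wf m : weight (fun l => mu l + m%:Z * ((l == j)%:Z - (l == i)%:Z)) (iter m f v).
  elim: m => [|m IHm]; first by apply: eq_weight wv => l; rewrite mul0r addr0.
  apply: eq_weight (weight_root j i IHm) => l; rewrite /add_root intS; ring.
have ef u : rho (E i j) (f u) = f (rho (E i j) u) + (rho (E i i) u - rho (E j j) u).
  by rewrite rho_comm !delta_mulE !eqxx !scale1r rhoB.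
have nij : (i == j) = false by apply/eqP => e; rewrite e ltnn in ij.
elim: k => [|k IHk].
  by rewrite /= ef hv // [f 0](linear0 (rho _)) add0r !wv -scalerBl -intrB mul1r subr0.
rewrite [iter k.+2 _ _]/= ef -/(iter k.+1 f v) IHk [f (_ *: _)](linearZZ (rho _)).
rewrite -/(iter k.+1 f v) !wf.
rewrite -scalerBl -scalerDl -intrB -intrD; congr (_%:~R *: _).
by rewrite !eqxx nij [j == i]eq_sym nij /= !intS; ring.
Qed.

Section Rational.
Variables r s : nat.
Hypothesis rat : rational_module r s rho.

Lemma weight_range mu v (S : {set 'I_n}) : weight mu v -> v != 0 ->
  - s%:Z <= \sum_(i in S) mu i <= r%:Z.
Proof.
move=> wv v0; have [L [_ Lrs] Lv] := rat S.
have := eigen_mem (gl_linV mod _) (weight_unit_sum S wv) (Lv v) v0.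
by move=> /mapP [l /Lrs lrs /(intr_inj_char0 charK0) ->].
Qed.

Lemma weight_range1 mu v i : weight mu v -> v != 0 -> - s%:Z <= mu i <= r%:Z.
Proof. by move=> wv v0; have := weight_range [set i] wv v0; rewrite big_set1. Qed.

(** The weights of f^k v decrease without bound, so f^(k+1) v = 0 for a first k; then
[highest_sl2] forces mu_i - mu_j = k. *)
Lemma highest_dominant mu v : weight mu v -> highest v -> v != 0 -> dominant mu.
Proof.
move=> wv hv v0 i j; rewrite leq_eqVlt => /orP [/eqP/val_inj-> //|ij].
set f := rho (E j i).
have wf m : rho (E i i) (iter m f v) = (mu i - m%:Z)%:~R *: iter m f v.
  elim: m => [|m IHm] /=; first by rewrite subr0 wv.
  rewrite rho_comm !delta_mulE eqxx scale1r IHm linearZ /=.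
  have -> : (i == j) = false by apply/eqP => e; rewrite e ltnn in ij.
  rewrite scale0r sub0r -[- E j i]scaleN1r rhoZ -scalerDl intS.
  by congr (_ *: _); rewrite !intrB !intrD; ring.
have [m fm0] : exists m, iter m f v == 0.
  have [L [_ Lrs] Lv] := rat [set i].
  exists (`|mu i + s%:Z|).+1; apply/negPn/negP => fm_neq0.
  have := Lv (iter (`|mu i + s%:Z|).+1 f v); rewrite /unit_sum big_set1 => Lf.
  have := eigen_mem (gl_linV mod _) (wf _) Lf fm_neq0.
  by move=> /mapP [l /Lrs lrs /(intr_inj_char0 charK0)]; lia.
have := ex_minnP (ex_intro (fun m => iter m f v == 0) m fm0).
case=> -[|k] fk0 kmin; first by rewrite (negPf v0) in fk0.
have fk_neq0 : iter k f v != 0 by apply/negP => /kmin; rewrite ltnn.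
have := highest_sl2 k ij wv hv; rewrite (eqP fk0) linear0 => /esym /eqP.
rewrite scaler_eq0 (negPf fk_neq0) orbF intr_eq0_char0 // mulf_eq0 /=.
by rewrite -subr_ge0 subr_eq0 => /eqP ->.
Qed.

(** Induction from the top: the weights of nonzero vectors have bounded height and a
raising operator increases the height. *)
Lemma highest_ind (P : ('I_n -> int) -> V -> Prop) :
  (forall mu, P mu 0) ->
  (forall mu v, weight mu v ->
     (forall i j : 'I_n, (i < j)%N -> P (add_root mu i j) (rho (E i j) v)) ->
     P mu v) ->
  forall mu v, weight mu v -> P mu v.
Proof.
move=> P0 IH mu v; pose B := (n * (n * (r + s)))%N.
have : B%:Z - height mu < `|B%:Z - height mu|%N.+1 by lia.
move: (`|B%:Z - height mu|%N.+1) => k lt_k.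
elim: k mu v lt_k => [|k IHk] mu v lt_k wv.
  have [-> //|v0] := eqVneq v 0.
  have := height_le_bound (fun i => weight_range1 i wv v0); rewrite -/B; lia.
apply: IH => // i j ij; apply: IHk; last exact: weight_root.
by rewrite height_add_root; lia.
Qed.

Section Submodule.
Variable C : V -> Prop.
Hypothesis C_lin : forall a u v, C u -> C v -> C (a *: u + v).
Hypothesis C_rho : forall X u, C u -> C (rho X u).

(** Simultaneous eigenvector of the commuting H_i in a submodule, one index after the
other. *)
Lemma weight_ex v : C v -> v != 0 -> exists mu u, [/\ weight mu u, C u & u != 0].
Proof.
move=> Cv v0; suff eig (e : seq 'I_n) : exists u, [/\ C u, u != 0 &
    {in e, forall i, exists m : int, rho (E i i) u = m%:~R *: u}].
  have [u [Cu u0 eu]] := eig (enum 'I_n).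
  have [i|mu wu] := fin_all_exists (P := fun i (m : int) => rho (E i i) u = m%:~R *: u).
    by apply: eu; rewrite mem_enum.
  by exists mu, u.
elim: e => [|i e [u [Cu u0 eu]]]; first by exists v.
pose D w := C w /\ {in e, forall i, exists m : int, rho (E i i) w = m%:~R *: w}.
have DT l w : D w -> D (rho (E i i) w - l *: w).
  move=> [Cw ew]; split=> [|k ke].
    by rewrite addrC -scaleNr; apply: C_lin => //; exact: C_rho.
  have [m wm] := ew k ke; exists m; rewrite linearB linearZ /= rho_comm wm linearZ /=.
  rewrite !delta_mulE; case: (eqVneq k i) => [->|_].
    by rewrite subrr rho0 addr0 scalerBr !scalerA mulrC.
  by rewrite !scale0r subrr rho0 addr0 scalerBr !scalerA [l * _]mulrC.
have [L [_ Lrs] Lv] := rat [set i]; rewrite /unit_sum big_set1 in Lv.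
have [l [w [lL [Cw ew] w0 lw]]] := eigen_ex DT (conj Cu eu) u0 (Lv u).
exists w; split=> // k; rewrite inE => /orP [/eqP->|/ew //].
by move/mapP: lL => [m _ lm]; exists m; rewrite lw lm.
Qed.

Lemma highest_ex v : C v -> v != 0 ->
  exists mu u, [/\ weight mu u, highest u, C u & u != 0].
Proof.
move=> Cv v0; have [mu [u [wu]]] := weight_ex Cv v0.
pose P (nu : 'I_n -> int) u := C u -> u != 0 ->
  exists mu u, [/\ weight mu u, highest u, C u & u != 0].
apply: (highest_ind (P := P)) wu => [nu _ /eqP //|nu {}u wu IH Cu u0].
have [hu|] := boolP [forall i : 'I_n, forall j : 'I_n, (i < j)%N ==> (rho (E i j) u == 0)].
  exists nu, u; split=> // i j ij; apply/eqP.
  by move/forallP/(_ i)/forallP/(_ j)/implyP: hu; exact.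
move=> /forallPn [i /forallPn [j]]; rewrite negb_imply => /andP [ij eu0].
by apply: (IH i j) => //; exact: C_rho.
Qed.
End Submodule.

(** The subspace n^- V. *)
Definition lowered (v : V) : Prop := lin_span
  (fun u => exists (i j : 'I_n) w, (i < j)%N /\ u = rho (E j i) w) v.

(** If e_ij v is nonzero, a polynomial in the Casimir element c turns it into a highest
vector of some dominant weight above mu, hence is killed by one more factor
c - l with l larger than the value at mu. The product of these polynomials over
all i < j makes v highest. *)
Lemma casimir_split_seq mu v : dominant mu -> weight mu v ->
  exists2 ls, (casimir_value mu)%:~R \notin ls & highest (shifts casimir ls v).
Proof.
move=> dmu wv; set a := _%:~R.
pose P nu v := weight_le mu nu ->
  exists2 ls, a \notin ls & highest (shifts casimir ls v).
suff : P mu v by apply=> nu.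
apply: (highest_ind (P := P)) wv => [nu _|nu {}v wv IH le_nu].
  by exists [::] => //; exact: highest0.
have kill (i j : 'I_n) : (i < j)%N ->
    exists2 ls, a \notin ls & shifts casimir ls (rho (E i j) v) = 0.
  move=> ij; have [ls als] := IH i j ij (weight_le_add_root ij le_nu).
  set u := shifts _ _ _ => hu; have [u0|u0] := eqVneq u 0; first by exists ls.
  have wu : weight (add_root nu i j) u.
    exact: weight_shifts_casimir (weight_root i j wv).
  exists ((casimir_value (add_root nu i j))%:~R :: ls); last first.
    by rewrite /= -/u (casimir_highest wu hu) subrr.
  rewrite inE negb_or als andbT; apply/eqP => /(intr_inj_char0 charK0) /eqP.
  apply/negP; rewrite lt_eqF //; apply: casimir_value_lt => //.
  - exact: highest_dominant wu hu u0.
  - exact: weight_le_add_root.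
  - rewrite height_add_root; have := le_nu _ (@two_rho_dominant n).
    by rewrite -/(height mu) -/(height nu); lia.
suff kill_seq (e : seq ('I_n * 'I_n)) : exists2 ls, a \notin ls &
    forall p : 'I_n * 'I_n, p \in e -> (p.1 < p.2)%N ->
      shifts casimir ls (rho (E p.1 p.2) v) = 0.
  have [ls als lse] := kill_seq (enum {: 'I_n * 'I_n}).
  exists ls => // i j ij; rewrite shifts_casimirC.
  by apply: (lse (i, j)); rewrite // mem_enum.
elim: e => [|[i j] e [ls als lse]]; first by exists [::].
have [ij|ji] := ltnP i j; last first.
  exists ls => // p; rewrite inE => /orP [/eqP-> /=|]; last exact: lse.
  by rewrite ltnNge ji.
have [ls' als' ls'0] := kill i j ij.
exists (ls' ++ ls) => [|p]; first by rewrite mem_cat negb_or als' als.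
rewrite shifts_cat inE => /orP [/eqP-> _ /=|pe pij].
  by rewrite (shiftsC casimir_linear) ls'0 (shifts0 casimir_linear).
by rewrite lse // (shifts0 casimir_linear).
Qed.

(** Complete reducibility at one dominant weight. By [casimir_weight] the operator
c - a, with a the Casimir value of mu, maps the weight space into n^- V. So
modulo n^- V the product \prod (c - l) of [casimir_split_seq] acts on v by the
nonzero scalar \prod (a - l), while it makes v highest. *)
Lemma weight_split mu v : dominant mu -> weight mu v ->
  exists2 z, weight mu z /\ highest z & lowered (v - z).
Proof.
move=> dmu wv; have [ls] := casimir_split_seq dmu wv.
set a := _%:~R => als hls.
have low u : weight mu u -> lowered (casimir u - a *: u).
  move=> wu; rewrite (casimir_weight wu) addrC addKr; apply: span_Z.
  elim/big_rec: _ => [|i y _ IH]; first exact: span_0.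
  apply: span_D => //; elim/big_rec: _ => [|j x ij IHx]; first exact: span_0.
  by apply: span_D => //; apply: span_gen; exists i, j, (rho (E i j) u).
pose split u := exists2 z, weight mu z /\ highest z & lowered (u - z).
have: split (shifts casimir ls v).
  exists (shifts casimir ls v); last by rewrite subrr; exact: span_0.
  by split=> //; exact: weight_shifts_casimir.
elim: ls als {hls} => //= l ls IH; rewrite inE negb_or => /andP [al als].
move=> [z [wz hz] zlow]; apply: IH => //.
set u := shifts _ _ _ in zlow *.
have wu : weight mu u by exact: weight_shifts_casimir.
have al0 : a - l != 0 by rewrite subr_eq0.
exists ((a - l)^-1 *: z).
  split; first by rewrite -[_ *: z]addr0; apply: weight_lin => //; exact: weight0.
  by rewrite -[_ *: z]addr0; apply: highest_lin => //; exact: highest0.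
have -> : u - (a - l)^-1 *: z = (a - l)^-1 *:
    ((casimir u - l *: u - z) + (-1) *: (casimir u - a *: u)).
  apply: (scalerI al0); rewrite scalerBr !scalerA divff // !scale1r scaleN1r.
  by rewrite opprB [RHS]addrC !addrA subrK scalerBl.
by apply: span_Z; apply: span_D => //; apply: span_Z; exact: low.
Qed.

End Rational.

(** The submodule generated by a highest weight vector w is spanned by the vectors
obtained from w by lowering operators. *)
Section Orbit.
Variables (mu : 'I_n -> int) (w : V).
Hypotheses (ww : weight mu w) (hw : highest w).

Inductive descendant : ('I_n -> int) -> V -> Prop :=
| descendant_self : descendant mu w
| descendant_lower nu u (i j : 'I_n) : (i < j)%N -> descendant nu u ->
    descendant (add_root nu j i) (rho (E j i) u).

Lemma descendant_weight nu u : descendant nu u -> weight nu u.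
Proof. by elim=> // {}nu {}u i j _ _; exact: weight_root. Qed.

Lemma descendant_le nu u : descendant nu u -> weight_le nu mu.
Proof. by elim=> [//|{}nu {}u i j ij _]; exact: weight_le_sub_root. Qed.

Lemma descendant_height nu u : descendant nu u -> u = w \/ height nu < height mu.
Proof.
case=> [|{}nu {}u i j ij du]; [by left|right].
have := descendant_le du (@two_rho_dominant n).
by rewrite -/(height nu) -/(height mu) height_add_root; lia.
Qed.

Definition orbit : V -> Prop := lin_span (fun u => exists nu, descendant nu u).

Lemma orbit_self : orbit w.
Proof. by apply: span_gen; exists mu; exact: descendant_self. Qed.

Lemma orbit_sum I (e : seq I) (P : pred I) F : (forall i, P i -> orbit (F i)) ->
  orbit (\sum_(i <- e | P i) F i).
Proof.
move=> orbF; elim/big_rec: _ => [|i x Pi]; first exact: span_0.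
by move=> ox; apply: span_D => //; exact: orbF.
Qed.

Lemma orbit_lower (i j : 'I_n) u : (i < j)%N -> orbit u -> orbit (rho (E j i) u).
Proof.
move=> ij; elim=> [x [nu dx]||x y _ ox _ oy|a x _ ox].
- by apply: span_gen; exists (add_root nu j i); exact: descendant_lower.
- by rewrite linear0; exact: span_0.
- by rewrite linearD; exact: span_D.
- by rewrite linearZ; exact: span_Z.
Qed.

(** X f u = f X u + [X, f] u reduces the stability to the generator w. *)
Lemma orbit_rho X u : orbit u -> orbit (rho X u).
Proof.
move=> ou; elim: ou X => [x [nu dx]||x y _ ox _ oy|a x _ ox] X.
- elim: dx X => [|{}nu {}x i j ij _ IH] X; last first.
    rewrite rho_comm; apply: span_D; last exact: IH.
    by apply: orbit_lower.
  rewrite rho_matrix; apply: orbit_sum => i _; apply: orbit_sum => j _.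
  apply: span_Z; case: (ssrnat.ltngtP i j) => [ij|ji|/ord_inj <-].
  + by rewrite hw //; exact: span_0.
  + by apply: orbit_lower => //; exact: orbit_self.
  + by rewrite ww; apply: span_Z; exact: orbit_self.
- by rewrite linear0; exact: span_0.
- by rewrite linearD; exact: (span_D (ox X) (oy X)).
- by rewrite linearZ; exact: (span_Z a (ox X)).
Qed.

(** For dominant nu, the element \sum nu_i H_i is diagonal on the spanning vectors with
eigenvalues at most (nu, mu), so [eigen_span] bounds the eigenvalue (nu, lam). *)
Lemma orbit_weight_le lam u : orbit u -> weight lam u -> u != 0 ->
  weight_le lam mu.
Proof.
move=> ou wu u0 nu dnu.
pose P (l : K) := exists2 m : int, l = m%:~R & m <= pairing nu mu.
have := eigen_span (gl_linV mod _) (P := P) _ (weight_diag nu wu) u0.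
case=> [|m /(intr_inj_char0 charK0)-> //].
elim: ou => [x [ka dx]||x y _ ox _ oy|a x _ ox].
- apply: span_gen; exists (pairing nu ka)%:~R.
    by exists (pairing nu ka) => //; exact: descendant_le dx _ dnu.
  exact: weight_diag (descendant_weight dx).
- exact: span_0.
- exact: span_D.
- exact: span_Z.
Qed.

(** All spanning vectors other than w have smaller height than w, so an eigenvector of
height equal to that of w has no component along them. *)
Lemma orbit_top lam u : orbit u -> weight lam u -> height lam = height mu ->
  exists k, u = k *: w.
Proof.
move=> ou wu hlam; set T := rho (\sum_i (two_rho i)%:~R *: E i i).
pose P (l : K) := exists2 m : int, l = m%:~R & m < height mu.
have [k] : exists k, lin_span (fun v => exists2 l, P l & T v = l *: v) (u - k *: w).
  elim: {wu} ou => [x [ka dx]||x y _ [k ox] _ [l oy]|a x _ [k ox]].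
  - have [->|lt] := descendant_height dx.
      by exists 1; rewrite scale1r subrr; exact: span_0.
    exists 0; rewrite scale0r subr0; apply: span_gen.
    exists (height ka)%:~R; first by exists (height ka).
    exact: weight_diag (descendant_weight dx).
  - by exists 0; rewrite scale0r subrr; exact: span_0.
  - by exists (k + l); rewrite scalerDl opprD addrACA; exact: span_D.
  - by exists (a * k); rewrite -scalerA -scalerBr; exact: span_Z.
move=> sp; exists k; apply/eqP; rewrite -subr_eq0; apply/negPn/negP => uk0.
have Tu : T (u - k *: w) = (height mu)%:~R *: (u - k *: w).
  rewrite /T linearB linearZ /=.
  rewrite (weight_diag _ wu) (weight_diag _ ww) -/(height lam) -/(height mu) hlam.
  by rewrite scalerBr !scalerA mulrC.
have [m /(intr_inj_char0 charK0) <-] := eigen_span (gl_linV mod _) sp Tu uk0.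
by rewrite ltxx.
Qed.

Lemma orbit_casimir u : orbit u -> casimir u = (casimir_value mu)%:~R *: u.
Proof.
elim=> [x [nu]||x y _ IHx _ IHy|a x _ IHx].
- elim=> [|{}nu {}x i j _ _ IH]; first exact: casimir_highest.
  by rewrite casimirC IH linearZ.
- by rewrite linear0 scaler0.
- by rewrite linearD /= IHx IHy scalerDr.
- by rewrite linearZ /= IHx !scalerA mulrC.
Qed.

End Orbit.

End Module.
End GlModules.

(** * Extending actions from gl_n to the enveloping algebra and its quotients *)

Lemma malg_scaleU (K : fieldType) (W : choiceType) (m : W) (a : K) :
  mkmalgU m a = a *: mkmalgU m 1 :> {malg K[W]}.
Proof. by apply/malgP => k; rewrite mcoeffZ !mcoeffU mulrnAr mulr1. Qed.

(** An action prescribed on generators is multiplicative as soon as the algebra is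
generated by them. *)
Section GeneratedAction.
Variables (K : fieldType) (I : Type) (A : algType K) (gen : I -> A).
Hypothesis A_ind : forall C : A -> Prop, C 1 ->
  (forall a x y, C x -> C y -> C (a *: x + y)) ->
  (forall i x, C x -> C (gen i * x)) -> forall x, C x.
Variables (V : lmodType K) (rho : I -> V -> V) (act : A -> V -> V).
Hypothesis actP : forall a x y v, act (a *: x + y) v = a *: act x v + act y v.
Hypothesis act_gen : forall i x v, act (gen i * x) v = rho i (act x v).
Hypothesis act1 : forall v, act 1 v = v.

Lemma generated_actM x y v : act (x * y) v = act x (act y v).
Proof.
elim/A_ind: x => [|a x1 x2 IH1 IH2|i x IH]; first by rewrite mul1r act1.
  by rewrite mulrDl -scalerAl !actP IH1 IH2.
by rewrite -mulrA !act_gen IH.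
Qed.
Lemma generated_act_gen i v : act (gen i) v = rho i v.
Proof. by rewrite -[gen i]mulr1 act_gen act1. Qed.

Lemma generated_actB x y v : act (x - y) v = act x v - act y v.
Proof. by rewrite addrC -[- y]scaleN1r actP scaleN1r addrC. Qed.

Lemma generated_act_env i j k a v :
  act (gen k - (a *: gen i + gen j)) v = rho k v - (a *: rho i v + rho j v) /\
  act (gen k - (gen i * gen j - gen j * gen i)) v
    = rho k v - (rho i (rho j v) - rho j (rho i v)).
Proof. by rewrite !generated_actB actP !act_gen !generated_act_gen. Qed.
End GeneratedAction.

Section FreeAction.
Variables (K : fieldType) (n : nat).
Local Notation F := (free_alg K n).
Local Notation word := {fmonom 'M[K]_n}.

Lemma free_gen_word X (m : seq 'M[K]_n) :
  mkmalgU (FMonom (X :: m)) 1 = free_gen X * mkmalgU (FMonom m) 1 :> F.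
Proof.
rewrite [RHS]malgM_def fgmulUU mulr1; congr mkmalgU.
by apply/eqP; rewrite fmP fmM fmU.
Qed.

(** The free algebra is spanned by words, and words are built by left multiplication
by generators. *)
Lemma free_ind (C : F -> Prop) : C 1 ->
  (forall a x y, C x -> C y -> C (a *: x + y)) ->
  (forall X x, C x -> C (free_gen X * x)) -> forall x, C x.
Proof.
move=> C1 C_lin C_gen x.
have C0 : C 0 by have := C_lin (-1) 1 1 C1 C1; rewrite scaleN1r addNr.
have Cw (m : word) : C (mkmalgU m 1).
  rewrite -(fmK m); elim: (m : seq _) => [|X s IH]; last by rewrite free_gen_word; exact: C_gen.
  by move: C1; congr C; congr mkmalgU; apply/eqP; rewrite fmP fm1.
rewrite (monalgE x); elim: (msupp x : seq _) => [|m s IH]; rewrite ?big_nil ?big_cons //.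
suff -> : mkmalgU m x@_m = x@_m *: mkmalgU m 1 :> F by apply: C_lin.
exact: malg_scaleU.
Qed.

Variables (V : lmodType K) (rho : 'M[K]_n -> V -> V).
Hypothesis linV : forall X, linear (rho X).
HB.instance Definition _ X := GRing.isLinear.Build K V V *:%R (rho X) (linV X).

Definition free_act (x : F) (v : V) : V :=
  \sum_(m <- msupp x) x@_m *: foldr rho v (m : word).

Lemma free_actEw (d : {fset word}) x v : (msupp x `<=` d)%fset ->
  free_act x v = \sum_(m <- d) x@_m *: foldr rho v m.
Proof.
move=> le; rewrite /free_act (big_fset_incl _ le) // => m md /mcoeff_outdom ->.
by rewrite scale0r.
Qed.

Lemma free_act_linl v : linear (free_act^~ v).
Proof.
move=> a x y; pose d := (msupp x `|` (msupp y `|` msupp (a *: x + y)))%fset.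
rewrite !(@free_actEw d) ?fsubsetUl ?fsubsetUr //; first last.
- by rewrite fsubsetU // fsubsetUr orbT.
- by rewrite fsubsetU // fsubsetUl orbT.
rewrite scaler_sumr -big_split; apply: eq_bigr => m _ /=.
by rewrite mcoeffD mcoeffZ scalerDl scalerA.
Qed.
Lemma free_actP a (x y : F) v : free_act (a *: x + y) v = a *: free_act x v + free_act y v.
Proof. exact: free_act_linl. Qed.

Let free_at v x := free_act x v.
HB.instance Definition _ v :=
  GRing.isLinear.Build K F V *:%R (free_at v) (free_act_linl v).

Lemma free_act_linr x : linear (free_act x).
Proof.
have lin_word (m : seq 'M[K]_n) : linear (foldr rho ^~ m).
  by elim: m => [|X m IH] a u v //=; rewrite IH linearP.
move=> a u v; rewrite /free_act scaler_sumr -big_split; apply: eq_bigr => m _ /=.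
by rewrite lin_word scalerDr !scalerA mulrC.
Qed.

Lemma free_act_word c (m : word) v : free_act (mkmalgU m c) v = c *: foldr rho v m.
Proof. by rewrite (free_actEw _ msuppU_le) big_seq_fset1 mcoeffUU. Qed.

Lemma free_act1 v : free_act 1 v = v.
Proof. by rewrite free_act_word fm1 scale1r. Qed.

Lemma free_act_gen_mul X (x : F) v : free_act (free_gen X * x) v = rho X (free_act x v).
Proof.
have gen_sum (e : seq word) (f : word -> K) (y := \sum_(m <- e) f m *: mkmalgU m 1 : F) :
    free_act (free_gen X * y) v = rho X (free_act y v).
  have -> : free_act y v = \sum_(m <- e) f m *: foldr rho v (m : word).
    rewrite -[LHS]/(free_at v y) linear_sum; apply: eq_bigr => m _.
    by rewrite linearZ /= /free_at free_act_word scale1r.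
  rewrite linear_sum -[LHS]/(free_at v _) mulr_sumr linear_sum.
  apply: eq_bigr => m _; rewrite -scalerAr !linearZ /=; congr (_ *: _).
  by rewrite -(fmK m) -free_gen_word /free_at free_act_word scale1r.
have := gen_sum (msupp x) (fun m => x@_m).
suff <- : x = \sum_(m <- msupp x) x@_m *: mkmalgU m 1 by [].
rewrite [LHS]monalgE; apply: eq_bigr => m _.
exact: malg_scaleU.
Qed.

Lemma free_act_gen X v : free_act (free_gen X) v = rho X v.
Proof. by rewrite -[free_gen X]mulr1 free_act_gen_mul free_act1. Qed.

Lemma free_actM (x y : F) v : free_act (x * y) v = free_act x (free_act y v).
Proof. exact: (generated_actM free_ind free_actP free_act_gen_mul free_act1). Qed.

End FreeAction.

Section QuotientAction.
Variables (K : fieldType) (V : lmodType K).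

(** Module structures over a possibly zero ring, hence over any quotient algebra. *)
Record ring_action (A : pzRingType) (act : A -> V -> V) : Prop := {
  action_linear : forall x, linear (act x);
  actionD : forall x y v, act (x + y) v = act x v + act y v;
  actionM : forall x y v, act (x * y) v = act x (act y v);
  action1 : forall v, act 1 v = v }.

Variables (A : algType K) (act : A -> V -> V) (P : A -> Prop).
Hypothesis actA : ring_action act.
Hypothesis actZ : forall a x v, act (a *: x) v = a *: act x v.
Hypothesis actP : forall x v, P x -> act x v = 0.

Lemma action0l v : act 0 v = 0.
Proof. by rewrite -(scale0r 0) actZ scale0r. Qed.

Lemma action0r x : act x 0 = 0.
Proof. by have := action_linear actA x (-1) 0 0; rewrite scaler0 addr0 scaleN1r addNr. Qed.

Lemma action_ideal x v : two_sided_ideal P x -> act x v = 0.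
Proof.
move=> Ix; elim: Ix v => [y Py|| y z _ IHy _ IHz|a y _ IH|a y _ IH] v.
- exact: actP.
- exact: action0l.
- by rewrite (actionD actA) IHy IHz addr0.
- by rewrite (actionM actA) IH action0r.
- by rewrite (actionM actA) IH.
Qed.

Definition quot_act (q : quot_alg P) (v : V) : V := act (repr q) v.

Lemma quot_actE x v : quot_act (quot_proj P x) v = act x v.
Proof.
rewrite /quot_act -[repr _](subrK x) (actionD actA) action_ideal ?add0r //.
exact: quot_reprP.
Qed.

Lemma quot_act_action : ring_action quot_act.
Proof.
split=> [q a u v|p q v|p q v|v]; first exact: (action_linear actA).
- elim/(@quot_ind K A P): p => x; elim/(@quot_ind K A P): q => y.
  by rewrite -rmorphD !quot_actE (actionD actA).
- elim/(@quot_ind K A P): p => x; elim/(@quot_ind K A P): q => y.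
  by rewrite -rmorphM !quot_actE (actionM actA).
- by rewrite -(rmorph1 (quot_proj P)) quot_actE (action1 actA).
Qed.

Lemma quot_actZ a q v : quot_act (a *: q) v = a *: quot_act q v.
Proof.
by elim/(@quot_ind K A P): q => x; rewrite -linearZ !quot_actE actZ.
Qed.
End QuotientAction.

Lemma quot_proj_bracket (K : fieldType) (A : algType K) (P : A -> Prop) (x y z : A) :
  z = x * y - y * x ->
  quot_proj P z = quot_proj P x * quot_proj P y - quot_proj P y * quot_proj P x.
Proof. by move=> ->; rewrite rmorphB !rmorphM. Qed.

(** Generation by [gen], as an induction principle, passes to quotients. *)
Lemma quot_generated (K : fieldType) (A : algType K) (P : A -> Prop) I (gen : I -> A) :
  (forall C : A -> Prop, C 1 ->
    (forall a x y, C x -> C y -> C (a *: x + y)) ->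
    (forall i x, C x -> C (gen i * x)) -> forall x, C x) ->
  forall C : quot_alg P -> Prop, C 1 ->
    (forall a x y, C x -> C y -> C (a *: x + y)) ->
    (forall i x, C x -> C (quot_proj P (gen i) * x)) -> forall x, C x.
Proof.
move=> A_ind C C1 C_lin C_gen x; elim/(@quot_ind K A P): x => x.
elim/A_ind: x => [|a x y IHx IHy|i x IH]; first by rewrite rmorph1.
  by rewrite linearP; exact: C_lin.
by rewrite rmorphM; exact: C_gen.
Qed.

Section RationalAction.
Variables (K : fieldType) (n r s : nat).
Local Notation U := (Ugl K n).
Local Notation Q := (quot_alg (@rat_rel K n r s)).

Definition Qin (X : 'M[K]_n) : Q := quot_proj (@rat_rel K n r s) (Ugl_in X).

Lemma Qin_linear : linear Qin.
Proof. by move=> a X Y; rewrite /Qin !linearP. Qed.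
HB.instance Definition _ := GRing.isLinear.Build K 'M[K]_n Q *:%R Qin Qin_linear.

Lemma Qin_bracket X Y : Qin (X *m Y - Y *m X) = Qin X * Qin Y - Qin Y * Qin X.
Proof.
exact: quot_proj_bracket (Ugl_in_bracket X Y).
Qed.

Lemma Q_ind (C : Q -> Prop) : C 1 ->
  (forall a x y, C x -> C y -> C (a *: x + y)) ->
  (forall X x, C x -> C (Qin X * x)) -> forall x, C x.
Proof.
move: C; apply: quot_generated; apply: quot_generated.
exact: free_ind.
Qed.

Variables (V : lmodType K) (rho : 'M[K]_n -> V -> V).
Hypothesis mod : gl_module rho.

Lemma free_act_action : ring_action (free_act rho).
Proof.
split=> [x|x y v|x y v|v].
- exact: free_act_linr (gl_linV mod) x.
- by rewrite -[x]scale1r free_actP !scale1r.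
- exact: free_actM (gl_linV mod) x y v.
- exact: free_act1.
Qed.

Lemma free_actZ a (x : free_alg K n) v : free_act rho (a *: x) v = a *: free_act rho x v.
Proof.
have f0 : free_act rho 0 v = 0.
  by have := free_actP rho (-1) 0 0 v; rewrite scaler0 addr0 scaleN1r addNr.
by have := free_actP rho a x 0 v; rewrite f0 !addr0.
Qed.

(** The two enveloping relations are the linearity and the bracket axiom of a
gl_n-module. *)
Lemma free_act_env x v : env_rel x -> free_act rho x v = 0.
Proof.
have env := generated_act_env (free_actP rho) (free_act_gen_mul (gl_linV mod)) (free_act1 rho).
case=> [a X Y|X Y].
  by apply: etrans (proj1 (env X Y _ a v)) _; rewrite (gl_linX mod) subrr.
by apply: etrans (proj2 (env X Y _ 0 v)) _; rewrite (gl_bracket mod) subrr.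
Qed.

Definition Uact : U -> V -> V := @quot_act K V _ (free_act rho) (@env_rel K n).

Lemma Uact_action : @ring_action K V U Uact.
Proof. exact: (quot_act_action free_act_action free_actZ free_act_env). Qed.

Lemma UactZ a (x : U) v : Uact (a *: x) v = a *: Uact x v.
Proof. exact: (quot_actZ free_act_action free_actZ free_act_env). Qed.

Lemma Uact_in X v : Uact (Ugl_in X) v = rho X v.
Proof.
rewrite /Uact (quot_actE free_act_action free_actZ free_act_env).
exact: free_act_gen (gl_linV mod) X v.
Qed.

End RationalAction.

(** * Rational expressions, their derivatives and lines in GL_n *)

Section Expressions.
Variables (K : fieldType) (n : nat).
Hypothesis charK0 : [pchar K] =i pred0.
Local Notation M := 'M[K]_n.
Local Notation G := (GLpt K n).

(** Polynomial expressions in the c_ij and d_ij, bihomogeneous of degree (r, s). The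
derivative of a function is computed on expressions, which can be interpreted
over K[t] as well as over K. *)
Inductive rexpr : nat -> nat -> Type :=
| Xc (i j : 'I_n) : rexpr 1 0
| Xd (i j : 'I_n) : rexpr 0 1
| Xzero r s : rexpr r s
| Xone : rexpr 0 0
| Xadd r s : rexpr r s -> rexpr r s -> rexpr r s
| Xscale r s (a : K) : rexpr r s -> rexpr r s
| Xmul r s r' s' : rexpr r s -> rexpr r' s' -> rexpr (r + r') (s + s').
Arguments Xzero {r s}.

Fixpoint interp (R : comNzRingType) (iota : K -> R) (c d : 'M[R]_n) r s
    (e : rexpr r s) : R :=
  match e with
  | Xc i j => c i j
  | Xd i j => d i j
  | Xzero _ _ => 0
  | Xone => 1
  | Xadd _ _ e1 e2 => interp iota c d e1 + interp iota c d e2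
  | Xscale _ _ a e1 => iota a * interp iota c d e1
  | Xmul _ _ _ _ e1 e2 => interp iota c d e1 * interp iota c d e2
  end.

Definition Xsum r s (F : 'I_n -> rexpr r s) : rexpr r s :=
  \big[@Xadd r s / Xzero]_k F k.

Lemma interp_sum R iota c d r s (F : 'I_n -> rexpr r s) :
  @interp R iota c d r s (Xsum F) = \sum_k interp iota c d (F k).
Proof. exact: (big_morph (@interp R iota c d r s)). Qed.

(** The derivation with c |-> c X and d |-> - X d, i.e. the derivative at t = 0 along
g (1 + t X). *)
Fixpoint dexpr (X : M) r s (e : rexpr r s) : rexpr r s :=
  match e in rexpr r s return rexpr r s with
  | Xc i j => Xsum (fun k => Xscale (X k j) (Xc i k))
  | Xd i j => Xsum (fun k => Xscale (- X i k) (Xd k j))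
  | Xzero _ _ => Xzero
  | Xone => Xzero
  | Xadd _ _ e1 e2 => Xadd (dexpr X e1) (dexpr X e2)
  | Xscale _ _ a e1 => Xscale a (dexpr X e1)
  | Xmul _ _ _ _ e1 e2 => Xadd (Xmul (dexpr X e1) e2) (Xmul e1 (dexpr X e2))
  end.

Definition eval r s (e : rexpr r s) : G -> K^o :=
  fun g => interp idfun (val g) (invmx (val g)) e.

Section Interp.
Variables (R : comNzRingType) (iota : {rmorphism K -> R}) (c d : 'M[R]_n).
Local Notation I := (interp iota c d).

Lemma interp_dc X i j : I (dexpr X (Xc i j)) = (c *m map_mx iota X) i j.
Proof.
by rewrite /= interp_sum mxE; apply: eq_bigr => k _; rewrite /= mxE mulrC.
Qed.

Lemma interp_dd X i j : I (dexpr X (Xd i j)) = - (map_mx iota X *m d) i j.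
Proof.
rewrite /= interp_sum mxE -sumrN; apply: eq_bigr => k _.
by rewrite /= mxE rmorphN mulNr.
Qed.

Lemma interp_dexpr_lin a X Y r s (e : rexpr r s) :
  I (dexpr (a *: X + Y) e) = iota a * I (dexpr X e) + I (dexpr Y e).
Proof.
elim: e => [i j|i j|{}r {}s||{}r {}s e1 IH1 e2 IH2|{}r {}s b e IH|{}r {}s r' s' e1 IH1 e2 IH2].
- by rewrite !interp_dc map_mxD map_mxZ mulmxDr -scalemxAr !mxE.
- by rewrite !interp_dd map_mxD map_mxZ mulmxDl -scalemxAl !mxE; ring.
- by rewrite /= mulr0 addr0.
- by rewrite /= mulr0 addr0.
- by rewrite /= IH1 IH2; ring.
- by rewrite /= IH; ring.
- by rewrite /= IH1 IH2; ring.
Qed.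

(** Both sides are derivations in e, so the identity is checked on the c_ij and d_ij. *)
Lemma interp_dexpr_bracket X Y r s (e : rexpr r s) :
  I (dexpr (X *m Y - Y *m X) e) = I (dexpr X (dexpr Y e)) - I (dexpr Y (dexpr X e)).
Proof.
have dsum Z r0 s0 (F : 'I_n -> rexpr r0 s0) :
    I (dexpr Z (Xsum F)) = \sum_k I (dexpr Z (F k)).
  exact: (big_morph (fun e : rexpr r0 s0 => I (dexpr Z e))).
elim: e => [i j|i j|{}r {}s||{}r {}s e1 IH1 e2 IH2|{}r {}s b e IH|{}r {}s r' s' e1 IH1 e2 IH2].
- rewrite interp_dc map_mxB !map_mxM /= mulmxBr !mulmxA !mxE !dsum.
  congr (_ - _); apply: eq_bigr => k _.
    by rewrite [RHS]/= -/(I _) -[Xsum _]/(dexpr X (Xc i k)) interp_dc !mxE mulrC.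
  by rewrite [RHS]/= -/(I _) -[Xsum _]/(dexpr Y (Xc i k)) interp_dc !mxE mulrC.
- rewrite interp_dd map_mxB !map_mxM /= mulmxBl -!mulmxA !mxE opprB !dsum.
  congr (_ - _); apply: eq_bigr => k _.
    by rewrite [RHS]/= -/(I _) -[Xsum _]/(dexpr X (Xd k j)) interp_dd !mxE rmorphN mulrNN.
  by rewrite [RHS]/= -/(I _) -[Xsum _]/(dexpr Y (Xd k j)) interp_dd !mxE rmorphN mulrNN.
- by rewrite /= subr0.
- by rewrite /= subr0.
- by rewrite /= IH1 IH2; ring.
- by rewrite /= IH; ring.
- by rewrite /= IH1 IH2; ring.
Qed.
End Interp.

Lemma interp_map (R S : comNzRingType) (f : {rmorphism R -> S}) iota (c d : 'M[R]_n) r s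
    (e : rexpr r s) :
  f (interp iota c d e) = interp (f \o iota) (map_mx f c) (map_mx f d) e.
Proof.
elim: e => [i j|i j|{}r {}s||{}r {}s e1 IH1 e2 IH2|{}r {}s b e IH|{}r {}s r' s' e1 IH1 e2 IH2] /=.
- by rewrite mxE.
- by rewrite mxE.
- exact: rmorph0.
- exact: rmorph1.
- by rewrite rmorphD IH1 IH2.
- by rewrite rmorphM IH.
- by rewrite rmorphM IH1 IH2.
Qed.

Lemma interp_scale (R : comNzRingType) (iota : K -> R) a (c d : 'M[R]_n) r s
    (e : rexpr r s) :
  interp iota c (a *: d) e = a ^+ s * interp iota c d e.
Proof.
elim: e => [i j|i j|{}r {}s||{}r {}s e1 IH1 e2 IH2|{}r {}s b e IH|{}r {}s r' s' e1 IH1 e2 IH2] /=.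
- by rewrite expr0 mul1r.
- by rewrite mxE expr1.
- by rewrite mulr0.
- by rewrite expr0 mulr1.
- by rewrite IH1 IH2 mulrDr.
- by rewrite IH mulrCA.
- by rewrite IH1 IH2 exprD mulrACA.
Qed.

Lemma eq_interp (R : comNzRingType) (iota iota' : K -> R) (c d : 'M[R]_n) r s
    (e : rexpr r s) : iota =1 iota' -> interp iota c d e = interp iota' c d e.
Proof. by move=> eq_iota; elim: e => //= *; congruence. Qed.

(** Along the line t |-> g (1 + t X) the entries of the inverse matrix have the
denominator det (1 + t X). Substituting the adjugate for the inverse clears it, so
an expression of degree (r, s) becomes det (1 + t X)^s times its value. *)
Section Line.
Variables (g : G) (X : M).
Let N : 'M[{poly K}]_n := 1%:M + 'X *: map_mx polyC X.
Let q : {poly K} := \det N.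
Let c := map_mx polyC (val g) *m N.
Let d := \adj N *m map_mx polyC (invmx (val g)).
Local Notation P := (interp polyC c d).

Definition line_det := q.
Definition line_coef : 'M[{poly K}]_n := \adj N *m map_mx polyC X.
Definition line_poly r s (e : rexpr r s) := P e.

Lemma line_ev (t : K) : map_mx (horner_eval t) N = 1%:M + t *: X.
Proof.
rewrite map_mxD map_mx1 map_mxZ -map_mx_comp /=.
rewrite /horner_eval hornerX; congr (_ + _ *: _).
by apply/matrixP => i j; rewrite !mxE /= hornerC.
Qed.

Lemma line_detE t : q.[t] = \det (1%:M + t *: X).
Proof. by rewrite -line_ev det_map_mx. Qed.

Lemma line_det0 : q.[0] = 1.
Proof. by rewrite line_detE scale0r addr0 det1. Qed.

Lemma line_det_neq0 : q != 0.
Proof.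
apply/eqP => q0; have := line_det0; rewrite q0 horner0 => /eqP.
by rewrite eq_sym oner_eq0.
Qed.

Lemma line_polyE r s (e : rexpr r s) t (h : G) :
  val h = val g *m (1%:M + t *: X) -> (P e).[t] = q.[t] ^+ s * eval e h.
Proof.
move=> hE; rewrite -[LHS]/(horner_eval t _) interp_map.
have -> : map_mx (horner_eval t) c = val h.
  rewrite map_mxM line_ev -map_mx_comp hE; congr (_ *m _).
  by apply/matrixP => i j; rewrite mxE /= /horner_eval hornerC.
have -> : map_mx (horner_eval t) d = q.[t] *: invmx (val h).
  rewrite map_mxM map_mx_adj line_ev -map_mx_comp line_detE.
  set Nt := 1%:M + _ in hE *.
  have -> : map_mx (horner_eval t \o polyC) (invmx (val g)) = invmx (val g).
    by apply/matrixP => i j; rewrite mxE /= /horner_eval hornerC.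
  have hU := valP h; apply: (can_inj (mulmxK hU)) => /=.
  rewrite -scalemxAl mulVmx // -/(val h) hE -mulmxA [invmx _ *m _]mulmxA.
  by rewrite mulVmx ?(valP g) // mul1mx mul_adj_mx scalemx1.
rewrite interp_scale; congr (_ * _); apply: eq_interp => a /=.
by rewrite /horner_eval hornerC.
Qed.

Lemma line_coef0 i j : (line_coef i j).[0] = X i j.
Proof.
transitivity (map_mx (horner_eval 0) line_coef i j); first by rewrite [RHS]mxE.
rewrite map_mxM map_mx_adj line_ev scale0r addr0 adj1 mul1mx.
by rewrite !mxE /= /horner_eval hornerC.
Qed.

Lemma deriv_mulmx (A B : 'M[{poly K}]_n) :
  map_mx (@deriv K) (A *m B) = map_mx (@deriv K) A *m B + A *m map_mx (@deriv K) B.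
Proof.
apply/matrixP => i j; rewrite !mxE linear_sum -big_split; apply: eq_bigr => k _ /=.
by rewrite derivM !mxE.
Qed.

Lemma deriv_const (A : M) : map_mx (@deriv K) (map_mx polyC A) = 0.
Proof. by apply/matrixP => i j; rewrite !mxE derivC. Qed.

(** At the point h = g (1 + t X) of the line the velocity g X is h Z with
Z = (1 + t X)^-1 X, so differentiating in t is differentiating along the
left-invariant field Z. Multiplied by the determinant this is a linear
differential system with polynomial coefficients, without division. *)
Lemma line_ode r s (e : rexpr r s) :
  line_det * (line_poly e)^`() = s%:R * line_det^`() * line_poly e
    + \sum_i \sum_j line_coef i j * line_poly (dexpr (delta_mx i j) e).
Proof.
rewrite /line_det /line_poly.
set A := line_coef.
have dN : map_mx (@deriv K) N = map_mx polyC X.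
  apply/matrixP => i j; rewrite !mxE derivD derivM derivX derivC mulr0 addr0 mul1r.
  by rewrite -polyC_natr derivC add0r.
have dadj : q *: map_mx (@deriv K) (\adj N) = q^`() *: \adj N - A *m \adj N.
  have := congr1 (map_mx (@deriv K)) (mul_adj_mx N); rewrite deriv_mulmx dN.
  have -> : map_mx (@deriv K) (q%:M : 'M_n) = (q^`())%:M.
    by apply/matrixP => i j; rewrite !mxE; case: eqP => _; rewrite ?mulr1n ?mulr0n ?linear0.
  move/(congr1 (mulmx^~ (\adj N))); rewrite mulmxDl -mulmxA mul_mx_adj mul_mx_scalar.
  by rewrite mul_scalar_mx -/q => <-; rewrite addrK.
have pickc (B : 'M[{poly K}]_n) :
    \sum_k \sum_l A k l *: (B *m map_mx polyC (delta_mx k l)) = B *m A.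
  rewrite [in RHS](matrix_sum_delta A) mulmx_sumr; apply: eq_bigr => k _.
  rewrite mulmx_sumr; apply: eq_bigr => l _.
  by rewrite map_delta_mx scalemxAr.
have pickd (B : 'M[{poly K}]_n) :
    \sum_k \sum_l A k l *: (map_mx polyC (delta_mx k l) *m B) = A *m B.
  rewrite [in RHS](matrix_sum_delta A) mulmx_suml; apply: eq_bigr => k _.
  rewrite mulmx_suml; apply: eq_bigr => l _.
  by rewrite map_delta_mx scalemxAl.
elim: e => [i j|i j|{}r {}s||{}r {}s e1 IH1 e2 IH2|{}r {}s b e IH|{}r {}s r' s' e1 IH1 e2 IH2].
- rewrite mul0r mul0r add0r.
  transitivity ((c *m A) i j).
    rewrite /c /A /line_coef -mulmxA [N *m _]mulmxA mul_mx_adj mul_scalar_mx -scalemxAr mxE.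
    have := deriv_mulmx (map_mx polyC (val g)) N; rewrite deriv_const mul0mx add0r dN => <-.
    by rewrite mxE.
  rewrite -pickc summxE; apply: eq_bigr => k _; rewrite summxE; apply: eq_bigr => l _.
  by rewrite interp_dc mxE.
- transitivity ((q^`() *: d - A *m d) i j); last first.
    rewrite mxE mul1r [in LHS]mxE -[in LHS]pickd; congr (_ + _).
    rewrite mxE summxE -sumrN; apply: eq_bigr => k _; rewrite summxE -sumrN; apply: eq_bigr => l _.
    by rewrite interp_dd mxE mulrN.
  rewrite /d mulmxA scalemxAl -mulmxBl -dadj -scalemxAl mxE.
  have := deriv_mulmx (\adj N) (map_mx polyC (invmx (val g))).
  by rewrite deriv_const mulmx0 addr0 => <-; rewrite [in RHS]mxE.
- by rewrite /= deriv0 !mulr0 add0r big1 // => i _; rewrite big1 // => j _; rewrite mulr0.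
- rewrite /= -polyC1 derivC !mulr0 mul0r mul0r add0r big1 // => i _.
  by rewrite big1 // => j _; rewrite mulr0.
- rewrite /= derivD mulrDr IH1 IH2 mulrDr addrACA -big_split; congr (_ + _).
  apply: eq_bigr => i _; rewrite -big_split; apply: eq_bigr => j _ /=.
  by rewrite mulrDr.
- rewrite /= derivM derivC mul0r add0r mulrCA IH mulrDr mulrCA mulr_sumr; congr (_ + _).
  apply: eq_bigr => i _; rewrite mulr_sumr; apply: eq_bigr => j _ /=.
  by rewrite mulrCA.
- rewrite /= derivM mulrDr mulrA IH1 mulrCA IH2 natrD.
  set S1 := \sum_i _; set S2 := \sum_i _; set S3 := \sum_i _.
  have -> : S3 = S1 * P e2 + P e1 * S2.
    rewrite mulr_suml mulr_sumr -big_split; apply: eq_bigr => i _.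
    rewrite mulr_suml mulr_sumr -big_split; apply: eq_bigr => j _ /=; ring.
  ring.
Qed.

End Line.

Lemma poly_eq0_char0 (p : {poly K}) : (forall t, p.[t] = 0) -> p = 0.
Proof.
move=> p0; apply/eqP/negPn/negP => p_neq0.
pose rs := [seq i%:R : K | i <- iota 0 (size p)].
have roots : all (root p) rs by apply/allP => t _; apply/eqP.
have rs_uniq : uniq rs.
  rewrite map_inj_uniq ?iota_uniq // => i j; rewrite !pmulrn.
  by move/(intr_inj_char0 charK0) => -[].
by have := max_poly_roots p_neq0 roots rs_uniq; rewrite size_map size_iota ltnn.
Qed.

Lemma line_poly_eq0 (g : G) X r s (e : rexpr r s) : (forall h, eval e h = 0) ->
  line_poly g X e = 0.
Proof.
move=> e0; suff /eqP : line_poly g X e * line_det X = 0.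
  by rewrite mulf_eq0 (negPf (line_det_neq0 X)) orbF => /eqP.
apply: poly_eq0_char0 => t; rewrite hornerM line_detE.
have [->|det0] := eqVneq (\det (1%:M + t *: X)) 0; first by rewrite mulr0.
have hU : val g *m (1%:M + t *: X) \in unitmx.
  by rewrite unitmx_mul (valP g) unitmxE unitfE.
by rewrite (line_polyE e (h := @exist 'M[K]_n (fun g => g \in unitmx) _ hU)) // e0 mulr0 mul0r.
Qed.

Lemma line_poly0 (g : G) X r s (e : rexpr r s) : (line_poly g X e).[0] = eval e g.
Proof.
rewrite (line_polyE e (h := g)) ?line_det0 ?expr1n ?mul1r //.
by rewrite scale0r addr0 mulmx1.
Qed.

Lemma eval_dexpr_matrix X r s (e : rexpr r s) g :
  eval (dexpr X e) g = \sum_i \sum_j X i j * eval (dexpr (delta_mx i j) e) g.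
Proof.
apply: (linear_matrix (F := fun Y => eval (dexpr Y e) g : K^o)) => a Y Z.
exact: (interp_dexpr_lin (R := K) idfun).
Qed.

Lemma line_deriv0 X r s (e : rexpr r s) (g : G) :
  (line_poly g X e)^`().[0]
    = s%:R * (line_det X)^`().[0] * eval e g + eval (dexpr X e) g.
Proof.
have := congr1 (horner_eval 0) (line_ode g X e).
rewrite linearD /= /horner_eval !hornerM line_det0 mul1r line_poly0 => ->.
rewrite -polyC_natr hornerC; congr (_ + _).
rewrite -[LHS]/(horner_eval 0 _) linear_sum eval_dexpr_matrix; apply: eq_bigr => i _.
rewrite linear_sum; apply: eq_bigr => j _.
by rewrite /= /horner_eval hornerM line_coef0 line_poly0.
Qed.

(** The derivative depends only on the function: an expression that vanishes on GL_n(K)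
has a zero line polynomial, as K is infinite. *)
Lemma eval_dexpr_eq0 X r s (e : rexpr r s) :
  (forall g, eval e g = 0) -> forall g, eval (dexpr X e) g = 0.
Proof.
move=> e0 g; have := line_deriv0 X e g.
by rewrite (line_poly_eq0 g X e0) deriv0 horner0 e0 mulr0 add0r.
Qed.

(** Taylor expansion. If a family of expressions stable under differentiation vanishes
at 1, its line polynomials through 1 are divisible by every power of t: when t^k
divides all of them, [line_ode] shows that it divides their derivatives (the
determinant is 1 at t = 0), and the constant terms vanish. The line from 1 to g,
with X = g - 1, then gives the value at g. *)
Lemma eval_vanish r s (C : rexpr r s -> Prop) :
  (forall X e, C e -> C (dexpr X e)) -> (forall e, C e -> eval e (GL1 K n) = 0) ->
  forall e, C e -> forall g, eval e g = 0.
Proof.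
move=> C_dexpr C1 e Ce g; pose X : M := val g - 1%:M.
have low k : forall e, C e -> forall i, (i < k)%N -> (line_poly (GL1 K n) X e)`_i = 0.
  elim: k => // k IHk {}e {}Ce [_|i]; first by rewrite -horner_coef0 line_poly0 C1.
  rewrite ltnS => ik.
  set p := line_poly _ X e.
  suff : p^`()`_i = 0.
    rewrite coef_deriv => /eqP; rewrite -mulr_natr mulf_eq0 natr_eq0_char0 //.
    by rewrite orbF => /eqP.
  have lowM a b : (forall j, (j < k)%N -> (b : {poly K})`_j = 0) ->
      forall j, (j < k)%N -> (a * b)`_j = 0.
    move=> bk j jk; rewrite coefM big1 // => l _.
    by rewrite bk ?mulr0 // (leq_ltn_trans _ jk) // leq_subr.
  have : forall j, (j < k)%N -> (line_det X * p^`())`_j = 0.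
    move=> j jk; rewrite /p line_ode coefD -mulrA lowM ?add0r //; last first.
      by apply: lowM; exact: IHk.
    rewrite coef_sum big1 // => a _; rewrite coef_sum big1 // => b _.
    by apply: lowM => //; apply: IHk; exact: C_dexpr.
  have [j] := ubnP i; elim: j i ik => // j IHj i ik ij qp.
  have := qp i ik; rewrite coefM big_ord_recl /= subn0.
  rewrite -horner_coef0 line_det0 mul1r big1 ?addr0 // => l _.
  rewrite /bump /= IHj ?mulr0 //; have := ltn_ord l; lia.
have : line_poly (GL1 K n) X e = 0.
  by apply/polyP => i; rewrite coef0 (low i.+1).
move/(congr1 (horner_eval 1)); rewrite /horner_eval horner0.
rewrite (line_polyE e (h := g)); last by rewrite scale1r mul1mx addrC subrK.
rewrite line_detE scale1r addrC subrK => /eqP; rewrite mulf_eq0 => /orP [|/eqP //].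
by rewrite expf_eq0 => /andP [_]; have := valP g; rewrite unitmxE unitfE => /negPf ->.
Qed.

End Expressions.

(** * The action of gl_n on A(n,r,s) by left-invariant derivations *)

Section Derivations.
Variables (K : fieldType) (n : nat).
Hypothesis charK0 : [pchar K] =i pred0.
Local Notation M := 'M[K]_n.
Local Notation G := (GLpt K n).
Local Notation rexpr := (rexpr K n).

Lemma eval_in r s (e : rexpr r s) : eval e \in @in_rat_coef K n r s.
Proof.
elim: e => [i j|i j|{}r {}s||{}r {}s e1 IH1 e2 IH2|{}r {}s a e IH|{}r {}s r' s' e1 IH1 e2 IH2].
- exact: coord_c_subproof.
- exact: coord_d_subproof.
- exact: rpred0.
- exact: rat_coef1_subproof.
- exact: rpredD.
- exact: rpredZ.
- exact: (rat_coefM_subproof (RatCoef IH1) (RatCoef IH2)).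
Qed.

Definition expr_coef r s (e : rexpr r s) : rat_coef K n r s := RatCoef (eval_in e).

(** Expressibility uniformly in the ring of values, so that one expression serves both
for a monomial function and for its first order jet at 1. *)
Definition expressible r s (F : forall R : comNzRingType, 'M[R]_n -> 'M[R]_n -> R) :=
  exists e : rexpr r s, forall (R : comNzRingType) iota (c d : 'M[R]_n),
    interp iota c d e = F R c d.

Lemma expressible_prod (I : Type) (l : seq I) (k m : I -> nat) F :
  (forall i, expressible (k i) (m i) (F i)) ->
  expressible (\sum_(i <- l) k i) (\sum_(i <- l) m i)
    (fun R c d => \prod_(i <- l) F i R c d).
Proof.
move=> exF; elim: l => [|i l [e IH]].
  by rewrite !big_nil; exists (Xone K n) => R iota c d; rewrite big_nil.
rewrite !big_cons; have [ei Ei] := exF i.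
by exists (Xmul ei e) => R iota c d; rewrite big_cons /= Ei IH.
Qed.

Lemma expressible_pow r s F k : expressible r s F ->
  expressible (k * r) (k * s) (fun R c d => F R c d ^+ k).
Proof.
move=> [e E]; elim: k => [|k [ek IH]]; first by exists (Xone K n).
by rewrite !mulSn; exists (Xmul e ek) => R iota c d; rewrite exprS /= E IH.
Qed.

Lemma expressibleM r s r' s' F F' : expressible r s F -> expressible r' s' F' ->
  expressible (r + r') (s + s') (fun R c d => F R c d * F' R c d).
Proof.
by move=> [e E] [e' E']; exists (Xmul e e') => R iota c d; rewrite /= E E'.
Qed.

Lemma monomial_expressible (a b : 'M[nat]_n) :
  expressible (exp_total a) (exp_total b)
    (fun R c d => (\prod_i \prod_j c i j ^+ a i j) * (\prod_i \prod_j d i j ^+ b i j)).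
Proof.
rewrite -[exp_total a]addn0 -[exp_total b]add0n; apply: expressibleM.
  have -> : 0%N = (\sum_(i < n) \sum_(j < n) 0)%N by rewrite big1 // => i _; rewrite big1.
  apply: expressible_prod => i; apply: expressible_prod => j.
  have := @expressible_pow 1 0 (fun R c d => c i j) (a i j).
  by rewrite muln1 muln0; apply; exists (Xc K i j).
have -> : 0%N = (\sum_(i < n) \sum_(j < n) 0)%N by rewrite big1 // => i _; rewrite big1.
apply: expressible_prod => i; apply: expressible_prod => j.
have := @expressible_pow 0 1 (fun R c d => d i j) (b i j).
by rewrite muln1 muln0; apply; exists (Xd K i j).
Qed.

Lemma rat_monomial_expr (a b : 'M[nat]_n) :
  exists e : rexpr (exp_total a) (exp_total b), rat_monomial a b = eval e.
Proof.
have [e E] := monomial_expressible a b.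
by exists e; apply/funext => g; rewrite /eval E.
Qed.

Definition jet_c (X : M) : 'M[{poly K}]_n := \matrix_(i, j) (((i == j)%:R)%:P + X i j *: 'X).
Definition jet_d (X : M) : 'M[{poly K}]_n := \matrix_(i, j) (((i == j)%:R)%:P - X i j *: 'X).

(** The coefficients of 1 and t in the value at the point 1 + t X over K[t]/(t^2). *)
Lemma jet_interp X r s (e : rexpr r s) :
  (interp polyC (jet_c X) (jet_d X) e)`_0 = eval e (GL1 K n) /\
  (interp polyC (jet_c X) (jet_d X) e)`_1 = eval (dexpr X e) (GL1 K n).
Proof.
have coef1M (p q : {poly K}) : (p * q)`_1 = p`_1 * q`_0 + p`_0 * q`_1.
  by rewrite coefM big_ord_recl big_ord1 /= addrC.
rewrite /eval /= invmx1.
elim: e => [i j|i j|{}r {}s||{}r {}s e1 [IH1 dIH1] e2 [IH2 dIH2]|{}r {}s a e [IH dIH]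
  |{}r {}s r' s' e1 [IH1 dIH1] e2 [IH2 dIH2]].
- rewrite (interp_dc (R := K) idfun) mul1mx /= !mxE !coefD !coefC !coefZ !coefX /=.
  by rewrite mulr0 addr0 mulr1 add0r.
- rewrite (interp_dd (R := K) idfun) mulmx1 /= !mxE !coefB !coefC !coefZ !coefX /=.
  by rewrite mulr0 subr0 mulr1 sub0r.
- by rewrite /= !coef0.
- by rewrite /= !coef1.
- by rewrite /= !coefD IH1 IH2 dIH1 dIH2.
- by rewrite /= !coefCM IH dIH.
- by rewrite /= coef0M coef1M IH1 IH2 dIH1 dIH2.
Qed.

Section Degree.
Variables r s : nat.
Local Notation A := (rat_coef K n r s).

Lemma rat_coef_expr (f : A) : exists e : rexpr r s, f = expr_coef e.
Proof.
suff [e E] : exists e : rexpr r s, rat_fun f = eval e.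
  by exists e; apply: rat_coefP => g; rewrite E.
case: f => f /= /asboolP; elim=> [_ [a b <- <-]||u v _ [e1 ->] _ [e2 ->]|a v _ [e ->]].
- exact: rat_monomial_expr.
- by exists (Xzero K n r s).
- by exists (Xadd e1 e2).
- by exists (Xscale a e).
Qed.

Definition der (X : M) (f : A) : A := expr_coef (dexpr X (projT1 (cid (rat_coef_expr f)))).

(** Independence of the chosen expression. *)
Lemma derE X (e : rexpr r s) : der X (expr_coef e) = expr_coef (dexpr X e).
Proof.
rewrite /der; case: cid => e' /= E; apply: rat_coefP => g /=; apply/eqP.
rewrite -subr_eq0; apply/eqP.
have := @eval_dexpr_eq0 K n charK0 X r s (Xadd e' (Xscale (-1) e)) _ g.
rewrite /eval /= mulN1r; apply=> h; rewrite mulN1r.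
by have := congr1 (fun f : A => f h) E; rewrite /= /eval => ->; rewrite subrr.
Qed.

Lemma expr_coefD e1 e2 : expr_coef (Xadd e1 e2) = expr_coef e1 + expr_coef e2 :> A.
Proof. exact: rat_coefP. Qed.
Lemma expr_coefZ a e : expr_coef (Xscale a e) = a *: expr_coef e :> A.
Proof. exact: rat_coefP. Qed.

Lemma der_module : gl_module der.
Proof.
split=> [f a X Y|X a f1 f2|X Y f].
- have [e ->] := rat_coef_expr f; rewrite !derE -expr_coefZ -expr_coefD.
  by apply: rat_coefP => g; exact: (interp_dexpr_lin (R := K) idfun).
- have [e1 ->] := rat_coef_expr f1; have [e2 ->] := rat_coef_expr f2.
  by rewrite -expr_coefZ -expr_coefD !derE -expr_coefZ -expr_coefD.
- have [e ->] := rat_coef_expr f; rewrite !derE.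
  by apply: rat_coefP => g; exact: (interp_dexpr_bracket (R := K) idfun).
Qed.

Lemma der_vanish (C : A -> Prop) : (forall X f, C f -> C (der X f)) ->
  (forall f, C f -> f (GL1 K n) = 0) -> forall f, C f -> f = 0.
Proof.
move=> C_der C1 f; have [e ->] := rat_coef_expr f => Ce; apply: rat_coefP => g /=.
apply: (@eval_vanish K n charK0 r s (fun e => C (expr_coef e))) Ce g => [X e' /(C_der X)|e' /C1 //].
by rewrite derE.
Qed.

(** A derivative can be read off from any expression of f along the line as a quotient
p / q of polynomials with q(0) = 1. *)
Lemma der_germ X (f : A) (g : G) (p q : {poly K}) : q.[0] = 1 ->
  (forall t (h : G), val h = val g *m (1%:M + t *: X) -> q.[t] * f h = p.[t]) ->
  der X f g = p^`().[0] - q^`().[0] * f g.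
Proof.
move=> q0 pq; have [e fE] := rat_coef_expr f.
pose P := line_poly g X e; pose det_s := line_det X ^+ s.
have fg : f g = p.[0].
  by rewrite -(pq 0 g) ?q0 ?mul1r // scale0r addr0 mulmx1.
have P0 : P.[0] = f g by rewrite line_poly0 fE.
have /(congr1 (fun u : {poly K} => u^`().[0])) : P * q = p * det_s.
  apply/eqP; rewrite -subr_eq0; suff : (P * q - p * det_s) * line_det X == 0.
    by rewrite mulf_eq0 (negPf (line_det_neq0 X)) orbF.
  apply/eqP/(poly_eq0_char0 charK0) => t; rewrite hornerM line_detE.
  have [->|det0] := eqVneq (\det (1%:M + t *: X)) 0; first by rewrite mulr0.
  have hU : val g *m (1%:M + t *: X) \in unitmx.
    by rewrite unitmx_mul (valP g) unitmxE unitfE.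
  pose h : G := @exist 'M[K]_n (fun g => g \in unitmx) _ hU.
  rewrite !hornerE (line_polyE e (h := h)) // -(pq t h) //.
  by rewrite fE /=; ring.
have det_s1 : det_s^`().[0] = s%:R * (line_det X)^`().[0].
  by rewrite deriv_exp hornerMn hornerM horner_exp line_det0 expr1n mulr1 mulr_natl.
rewrite !derivM !hornerD !hornerM q0 det_s1 horner_exp line_det0 expr1n P0 -fg !mulr1.
have fgE : f g = eval e g by rewrite fE.
have -> : der X f g = eval (dexpr X e) g by rewrite fE derE.
rewrite line_deriv0 -fgE => PE.
have -> : p^`().[0] = eval (dexpr X e) g + f g * q^`().[0].
  by apply: (addIr (f g * (s%:R * (line_det X)^`().[0]))); rewrite -PE; ring.
by rewrite [f g * _]mulrC addrK.
Qed.

(** Left translation by g maps the line through h to the line through g h. *)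
Lemma der_translate X (f : A) g : der X (rat_translate f g) = rat_translate (der X f) g.
Proof.
apply: rat_coefP => h; have [e fE] := rat_coef_expr f.
pose p := line_poly (GLmul g h) X e; pose q := line_det X ^+ s.
have q0 : q.[0] = 1 by rewrite horner_exp line_det0 expr1n.
rewrite (@der_germ X _ h p q) //; last first.
  move=> t k kE; rewrite fE /= horner_exp (line_polyE e (h := GLmul g k)) //=.
  by rewrite kE mulmxA.
rewrite -[RHS]/(der X f (GLmul g h)) (@der_germ X f (GLmul g h) p q) // => t k kE.
by rewrite fE /= horner_exp (line_polyE e (h := k)).
Qed.

Lemma deriv_prod_at0 (x : 'I_n -> K) (alpha : 'I_n -> nat)
    (p := \prod_i (1 + x i *: 'X) ^+ alpha i) :
  p.[0] = 1 /\ p^`().[0] = \sum_i (alpha i)%:R * x i.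
Proof.
apply: (big_ind2 (fun (u : {poly K}) v => u.[0] = 1 /\ u^`().[0] = v))
  => [|u v w y [u0 <-] [w0 <-]|i _].
- by rewrite -polyC1 derivC !hornerC.
- by rewrite derivM hornerD !hornerM u0 w0 !mulr1 mul1r addrC.
have X0 : (1 + x i *: 'X : {poly K}).[0] = 1 by rewrite !hornerE.
rewrite horner_exp X0 expr1n deriv_exp hornerMn hornerM horner_exp X0 expr1n.
by rewrite mulr1 derivD -polyC1 derivC add0r derivZ derivX hornerZ hornerC mulr1 mulr_natl.
Qed.

(** A function that is multiplied by \prod (1 + t X_ii)^(alpha_i - beta_i) along
1 + t X is an eigenvector of X. *)
Lemma der_semiinvariant X (f : A) (alpha beta : 'I_n -> nat) :
  (forall t (g h : G), val h = val g *m (1%:M + t *: X) ->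
    f h * \prod_i (1 + t * X i i) ^+ beta i = f g * \prod_i (1 + t * X i i) ^+ alpha i) ->
  der X f = (\sum_i ((alpha i)%:R - (beta i)%:R) * X i i) *: f.
Proof.
move=> semi; apply: rat_coefP => g.
pose p a : {poly K} := \prod_i (1 + X i i *: 'X) ^+ a i.
have pE a t : (p a).[t] = \prod_i (1 + t * X i i) ^+ a i.
  rewrite horner_prod; apply: eq_bigr => i _; rewrite horner_exp !hornerE; congr (_ ^+ _); ring.
have [pa0 pa1] := deriv_prod_at0 (fun i => X i i) alpha.
have [pb0 pb1] := deriv_prod_at0 (fun i => X i i) beta.
rewrite (@der_germ X f g (f g *: p alpha) (p beta)) //.
  rewrite derivZ hornerZ /p pa1 pb1.
  rewrite -[RHS]/((\sum_i ((alpha i)%:R - (beta i)%:R) * X i i) * f g).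
  rewrite mulrC -mulrBl -sumrB; congr (_ * _); apply: eq_bigr => i _.
  by rewrite mulrBl.
by move=> t h hE; rewrite hornerZ !pE mulrC; exact: semi.
Qed.

Lemma tangent_der X (a b : 'M[nat]_n) (f : A) :
  exp_total a = r -> exp_total b = s -> rat_fun f = rat_monomial a b ->
  der X f (GL1 K n) = tangent_monomial X a b.
Proof.
move=> ra sb fE; have [e E] := monomial_expressible a b.
rewrite ra sb in e E; pose cT := jet_c X; pose dT := jet_d X.
have -> : f = expr_coef e.
  by apply: rat_coefP => g; rewrite fE /= /eval E.
rewrite derE -[LHS]/(eval (dexpr X e) (GL1 K n)) -(proj2 (jet_interp X e)) E.
rewrite /tangent_monomial.
by congr nth; congr (polyseq (_ * _)); apply: eq_bigr => i _; apply: eq_bigr => j _;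
  rewrite mxE.
Qed.

End Degree.
End Derivations.

(** * Highest weight vectors and weight vectors in A(n,r,s) *)

Lemma PoszD_sum (I : finType) (P : pred I) (F : I -> nat) :
  ((\sum_(i | P i) F i)%N)%:Z = \sum_(i | P i) (F i)%:Z.
Proof. exact: (big_morph Posz PoszD). Qed.

Section HighestFunctions.
Variables (K : fieldType) (n : nat).
Hypothesis charK0 : [pchar K] =i pred0.
Local Notation M := 'M[K]_n.
Local Notation G := (GLpt K n).
Implicit Types (S : {set 'I_n}) (N Y : M) (alpha beta : 'I_n -> nat).

Definition upper Y := forall i j : 'I_n, (j < i)%N -> Y i j = 0.

(** The principal submatrix on S, completed by the identity to keep the size n, so that
its determinant is the principal minor on S. *)
Definition block S N : M :=
  \matrix_(i, j) (if (i \in S) && (j \in S) then N i j else (i == j)%:R).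
Definition minor S N : K := \det (block S N).

(** When S is an initial segment, the entries Y k j with k outside S and j in S lie
below the diagonal of the upper triangular Y. *)
Lemma block_mulr S N Y : upper Y ->
  (forall i j : 'I_n, (i <= j)%N -> j \in S -> i \in S) ->
  block S (N *m Y) = block S N *m block S Y.
Proof.
move=> upY lowS; apply/matrixP => i j; rewrite !mxE.
have [iS|iS] /= := boolP (i \in S); last first.
  rewrite (bigD1 i) //= big1 => [|k ki]; rewrite !mxE (negPf iS) /=.
    by rewrite eqxx mul1r addr0.
  by rewrite eq_sym (negPf ki) mul0r.
have [jS|jS] := boolP (j \in S); last first.
  rewrite (bigD1 j) //= big1 => [|k kj]; rewrite !mxE (negPf jS) andbF.
    by rewrite eqxx mulr1 addr0.
  by rewrite (negPf kj) mulr0.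
apply: eq_bigr => k _; rewrite !mxE iS jS /= andbT; case: ifP => // kS.
rewrite upY ?mulr0 //; last first.
  by rewrite ltnNge; apply/negP => /lowS /(_ jS); rewrite kS.
by case: eqP => [ik|_]; [rewrite -ik iS in kS|rewrite mul0r].
Qed.

Lemma block_mull S N Y : upper Y ->
  (forall i j : 'I_n, (i <= j)%N -> i \in S -> j \in S) ->
  block S (Y *m N) = block S Y *m block S N.
Proof.
move=> upY upS; apply/matrixP => i j; rewrite !mxE.
have [iS|iS] /= := boolP (i \in S); last first.
  rewrite (bigD1 i) //= big1 => [|k ki]; rewrite !mxE (negPf iS) /=.
    by rewrite eqxx mul1r addr0.
  by rewrite eq_sym (negPf ki) mul0r.
have [jS|jS] := boolP (j \in S); last first.
  rewrite (bigD1 j) //= big1 => [|k kj]; rewrite !mxE (negPf jS) andbF.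
    by rewrite eqxx mulr1 addr0.
  by rewrite (negPf kj) mulr0.
apply: eq_bigr => k _; rewrite !mxE iS jS /= andbT; case: ifP => // kS.
rewrite upY ?mul0r //; last first.
  by rewrite ltnNge; apply/negP => /upS /(_ iS); rewrite kS.
by case: eqP => [ik|_]; [rewrite -ik iS in kS|rewrite mul0r].
Qed.

Lemma minor_upper S Y : upper Y -> minor S Y = \prod_i Y i i ^+ (i \in S).
Proof.
move=> upY; rewrite /minor -det_tr det_trig; last first.
  apply/is_trig_mxP => i j ij; rewrite !mxE upY //; case: ifP => // _.
  by rewrite eq_sym -val_eqE /= (ltn_eqF ij).
by apply: eq_bigr => i _; rewrite !mxE andbb eqxx; case: (i \in S).
Qed.

Lemma minor1 S : minor S 1%:M = 1.
Proof.
rewrite minor_upper; last by move=> i j ij; rewrite mxE -val_eqE /= (gtn_eqF ij).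
by rewrite big1 // => i _; rewrite mxE eqxx expr1n.
Qed.

Lemma in_rat_coefM r s r' s' (f f' : G -> K^o) :
  f \in @in_rat_coef K n r s -> f' \in @in_rat_coef K n r' s' ->
  (fun g => f g * f' g : K^o) \in @in_rat_coef K n (r + r') (s + s').
Proof. by move=> Af Af'; exact: (rat_coefM_subproof (RatCoef Af) (RatCoef Af')). Qed.

Lemma in_rat_coef_prod (I : Type) (l : seq I) (k m : I -> nat) (F : I -> G -> K^o) :
  (forall i, F i \in @in_rat_coef K n (k i) (m i)) ->
  (fun g => \prod_(i <- l) F i g : K^o)
    \in @in_rat_coef K n (\sum_(i <- l) k i) (\sum_(i <- l) m i).
Proof.
move=> AF; elim: l => [|i l IH].
  rewrite !big_nil (_ : (fun g => _) = fun=> 1); first exact: rat_coef1_subproof.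
  by apply/funext => g; rewrite big_nil.
rewrite !big_cons (_ : (fun g => _) = fun g => F i g * \prod_(j <- l) F j g).
  exact: in_rat_coefM.
by apply/funext => g; rewrite big_cons.
Qed.

Lemma in_rat_coef_const (a : K) : (fun=> a : K^o) \in @in_rat_coef K n 0 0.
Proof.
rewrite (_ : (fun=> a) = a *: ((fun=> 1) : G -> K^o)).
  by apply: rpredZ; exact: rat_coef1_subproof.
by apply/funext => g; apply/esym/mulr1.
Qed.

Lemma in_rat_coef_sum r s (I : finType) (F : I -> G -> K^o) :
  (forall i, F i \in @in_rat_coef K n r s) -> \sum_i F i \in @in_rat_coef K n r s.
Proof. by move=> AF; apply: rpred_sum => i _; exact: AF. Qed.

Lemma in_rat_coef_minor S r s (X : 'I_n -> 'I_n -> G -> K^o) :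
  (forall i j, X i j \in @in_rat_coef K n r s) ->
  (fun g => minor S (\matrix_(i, j) X i j g) : K^o)
    \in @in_rat_coef K n (\sum_i (i \in S) * r) (\sum_i (i \in S) * s).
Proof.
move=> AX; rewrite (_ : (fun g => _) = \sum_(sigma : 'S_n) (-1) ^+ sigma *:
   ((fun g => \prod_i block S (\matrix_(i, j) X i j g) i (sigma i)) : G -> K^o)).
  apply: in_rat_coef_sum => sigma; apply: rpredZ.
  apply: in_rat_coef_prod => i.
  have [iS|iS] := boolP (i \in S); last first.
    rewrite !mul0n (_ : (fun g => _) = fun=> (i == sigma i)%:R : K^o).
      exact: in_rat_coef_const.
    by apply/funext => g; rewrite mxE (negPf iS).
  rewrite !mul1n; have [jS|jS] := boolP (sigma i \in S).
    rewrite (_ : (fun g => _) = X i (sigma i)) //.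
    by apply/funext => g; rewrite mxE iS jS mxE.
  rewrite (_ : (fun g => _) = 0) ?rpred0 //.
  apply/funext => g; rewrite mxE (negPf jS) andbF; case: eqP => // E.
  by rewrite -E iS in jS.
by apply/funext => g; rewrite fct_sumE.
Qed.

(** Normalized semi-invariants of weight alpha - beta for right multiplication by upper
triangular matrices. *)
Definition upper_semiinvariant r s alpha beta (f : G -> K^o) := [/\
  f \in @in_rat_coef K n r s, f (GL1 K n) = 1 &
  forall (g h : G) Y, upper Y -> val h = val g *m Y ->
    f h * \prod_i Y i i ^+ beta i = f g * \prod_i Y i i ^+ alpha i].

Lemma upper_semiinvariantM r s alpha beta f r' s' alpha' beta' f' :
  upper_semiinvariant r s alpha beta f -> upper_semiinvariant r' s' alpha' beta' f' ->
  upper_semiinvariant (r + r') (s + s') (fun i => alpha i + alpha' i)%N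
    (fun i => beta i + beta' i)%N (fun g => f g * f' g).
Proof.
move=> [Af f1 fY] [Af' f'1 f'Y]; split; first exact: in_rat_coefM.
  by rewrite f1 f'1 mulr1.
move=> g h Y upY hE.
have split_exp (c c' : 'I_n -> nat) : \prod_i Y i i ^+ (c i + c' i) =
    (\prod_i Y i i ^+ c i) * \prod_i Y i i ^+ c' i.
  by rewrite -big_split; apply: eq_bigr => i _; rewrite exprD.
by rewrite !split_exp mulrACA (fY _ _ _ upY hE) (f'Y _ _ _ upY hE) mulrACA.
Qed.

Lemma minor_c_semiinvariant S : (forall i j : 'I_n, (i <= j)%N -> j \in S -> i \in S) ->
  upper_semiinvariant (\sum_i (i \in S)) 0 (fun i => i \in S) (fun=> 0%N)
    (fun g => minor S (val g)).
Proof.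
move=> lowS; split; last first.
- move=> g h Y upY ->; rewrite big1 // mulr1 -minor_upper // /minor.
  by rewrite block_mulr // det_mulmx.
- exact: minor1.
have := in_rat_coef_minor S (@coord_c_subproof K n).
rewrite (eq_bigr (fun i => nat_of_bool (i \in S))) => [|i _]; last by rewrite muln1.
rewrite [X in _ \in in_rat_coef _ X]big1 => [|i _]; last by rewrite muln0.
suff -> : (fun g : G => minor S (val g) : K^o) =
    fun g => minor S (\matrix_(i, j) coord_c i j g) by [].
by apply/funext => g; congr minor; apply/matrixP => i j; rewrite mxE.
Qed.

Lemma minor_d_semiinvariant S : (forall i j : 'I_n, (i <= j)%N -> i \in S -> j \in S) ->
  upper_semiinvariant 0 (\sum_i (i \in S)) (fun=> 0%N) (fun i => i \in S)
    (fun g => minor S (invmx (val g))).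
Proof.
move=> upS; split; last first.
- move=> g h Y upY hE; rewrite [X in _ = _ * X]big1 // mulr1.
  rewrite -minor_upper // mulrC /minor -det_mulmx -block_mull //.
  congr (\det (block S _)); apply: (can_inj (mulKmx (valP g))).
  by rewrite mulmxA -hE (mulmxV (valP h)) (mulmxV (valP g)).
- by rewrite invmx1; exact: minor1.
have := in_rat_coef_minor S (@coord_d_subproof K n).
rewrite [X in _ \in in_rat_coef X _]big1 => [|i _]; last by rewrite muln0.
rewrite (eq_bigr (fun i => nat_of_bool (i \in S))) => [|i _]; last by rewrite muln1.
suff -> : (fun g : G => minor S (invmx (val g)) : K^o) =
    fun g => minor S (\matrix_(i, j) coord_d i j g) by [].
by apply/funext => g; congr minor; apply/matrixP => i j; rewrite mxE.
Qed.

(** The identity \sum_k c_0k d_k0 = 1 puts the constant 1 in A(m, m), which pads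
degrees without changing weights. *)
Lemma one_semiinvariant m : (0 < n)%N ->
  upper_semiinvariant m m (fun=> 0%N) (fun=> 0%N) (fun=> 1).
Proof.
move=> n_gt0; split=> //.
pose i0 := Ordinal n_gt0.
have A11 : (fun=> 1 : K^o) \in @in_rat_coef K n 1 1.
  rewrite (_ : (fun=> 1) = \sum_k (fun g => coord_c i0 k g * coord_d k i0 g : K^o)).
    apply: in_rat_coef_sum => k.
    have := in_rat_coefM (coord_c_subproof K i0 k) (coord_d_subproof K k i0).
    by rewrite addn0 add0n.
  apply/funext => g; rewrite fct_sumE.
  have /matrixP/(_ i0 i0) := mulmxV (valP g).
  by rewrite !mxE eqxx => /esym.
elim: m => [|m IH]; first exact: in_rat_coef_const.
have := in_rat_coefM A11 IH; rewrite !add1n.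
by rewrite (_ : (fun g => _) = fun=> 1) //; apply/funext => g; rewrite mulr1.
Qed.

Lemma eq_upper_semiinvariant r s alpha beta r' s' alpha' beta' f :
  r = r' -> s = s' -> alpha =1 alpha' -> beta =1 beta' ->
  upper_semiinvariant r s alpha beta f -> upper_semiinvariant r' s' alpha' beta' f.
Proof.
move=> <- <- ea eb [Af f1 fY]; split=> // g h Y upY hE.
under eq_bigr => i _ do rewrite -eb.
by under [in RHS]eq_bigr => i _ do rewrite -ea; exact: fY.
Qed.

(** Decreasing all positive entries of a partition by one leaves a partition; the
support is an initial segment, and its minor restores these entries. *)
Lemma positive_semiinvariant alpha :
  (forall i j : 'I_n, (i <= j)%N -> (alpha j <= alpha i)%N) ->
  exists f, upper_semiinvariant (\sum_i alpha i) 0 alpha (fun=> 0%N) f.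
Proof.
have [m] : exists m, forall i, (alpha i <= m)%N by exists (\max_i alpha i) => i; exact: leq_bigmax.
elim: m alpha => [|m IH] alpha le_m anti.
  exists (fun=> 1); apply: (@eq_upper_semiinvariant 0 0 (fun=> 0%N) (fun=> 0%N)) => //.
  - by rewrite big1 // => i _; apply/eqP; rewrite -leqn0.
  - by move=> i; apply/esym/eqP; rewrite -leqn0.
  by split=> //; exact: in_rat_coef_const.
have [i|i j ij|f fP] := IH (fun i => (alpha i).-1).
- by have := le_m i; lia.
- by have := anti i j ij; lia.
pose S := [set i | (0 < alpha i)%N].
have lowS (i j : 'I_n) : (i <= j)%N -> j \in S -> i \in S.
  by move=> /anti; rewrite !inE => le lt; apply: leq_trans lt le.
exists (fun g => f g * minor S (val g)).
apply: eq_upper_semiinvariant (upper_semiinvariantM fP (minor_c_semiinvariant lowS)) => //.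
  by rewrite -big_split; apply: eq_bigr => i _; rewrite /= inE; lia.
by move=> i; rewrite inE; lia.
Qed.

(** The dual construction, with final segments and minors of the inverse matrix. *)
Lemma negative_semiinvariant beta :
  (forall i j : 'I_n, (i <= j)%N -> (beta i <= beta j)%N) ->
  exists f, upper_semiinvariant 0 (\sum_i beta i) (fun=> 0%N) beta f.
Proof.
have [m] : exists m, forall i, (beta i <= m)%N by exists (\max_i beta i) => i; exact: leq_bigmax.
elim: m beta => [|m IH] beta le_m mono.
  exists (fun=> 1); apply: (@eq_upper_semiinvariant 0 0 (fun=> 0%N) (fun=> 0%N)) => //.
  - by rewrite big1 // => i _; apply/eqP; rewrite -leqn0.
  - by move=> i; apply/esym/eqP; rewrite -leqn0.
  by split=> //; exact: in_rat_coef_const.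
have [i|i j ij|f fP] := IH (fun i => (beta i).-1).
- by have := le_m i; lia.
- by have := mono i j ij; lia.
pose S := [set i | (0 < beta i)%N].
have upS (i j : 'I_n) : (i <= j)%N -> i \in S -> j \in S.
  by move=> /mono; rewrite !inE => le lt; apply: leq_trans lt le.
exists (fun g => f g * minor S (invmx (val g))).
apply: eq_upper_semiinvariant (upper_semiinvariantM fP (minor_d_semiinvariant upS)) => //.
  by rewrite -big_split; apply: eq_bigr => i _; rewrite /= inE; lia.
by move=> i; rewrite inE; lia.
Qed.

(** The positive and negative parts of mu are the weights of a product of minors of g
and a product of minors of its inverse. The bounds on the sums of mu over the sets
of nonnegative and negative entries make their degrees at most r and s, with equal
defects because the total is r - s; the constant 1 of A(m, m) fills the defect. *)
Lemma highest_function r s (mu : 'I_n -> int) : (0 < n)%N -> dominant mu ->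
  (forall S, - s%:Z <= \sum_(i in S) mu i <= r%:Z) -> \sum_i mu i = r%:Z - s%:Z ->
  exists f : rat_coef K n r s,
    [/\ f != 0, weight (@der K n r s) mu f & highest (@der K n r s) f].
Proof.
move=> n_gt0 dmu mu_rs mu_tot.
pose alpha i := absz (if 0 <= mu i then mu i else 0).
pose beta i := absz (if 0 <= mu i then 0 else mu i).
have mu_ab i : mu i = (alpha i)%:Z - (beta i)%:Z.
  by rewrite /alpha /beta; case: ifP => mu_i; lia.
have [|fa faP] := @positive_semiinvariant alpha.
  move=> i j /dmu; rewrite /alpha; case: ifP => mu_i; case: ifP => mu_j; lia.
have [|fb fbP] := @negative_semiinvariant beta.
  move=> i j /dmu; rewrite /beta; case: ifP => mu_i; case: ifP => mu_j; lia.
have le_r : (\sum_i alpha i <= r)%N.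
  suff E : (\sum_i alpha i)%N%:Z = \sum_(i in [set i | 0 <= mu i]) mu i.
    by have := mu_rs [set i | 0 <= mu i]; rewrite -E; lia.
  rewrite PoszD_sum [RHS]big_mkcond; apply: eq_bigr => i _.
  by rewrite inE /alpha; case: ifP => mu_i; lia.
have tot : (\sum_i alpha i)%N%:Z - (\sum_i beta i)%N%:Z = r%:Z - s%:Z.
  by rewrite -mu_tot !PoszD_sum -sumrB; apply: eq_bigr => i _; rewrite mu_ab.
pose m := (r - \sum_i alpha i)%N.
have := upper_semiinvariantM (upper_semiinvariantM faP fbP) (one_semiinvariant m n_gt0).
move/(@eq_upper_semiinvariant _ _ _ _ r s alpha beta); case=> [||i|i|Af f1 fY]; rewrite ?addn0 //.
- by rewrite /m; lia.
- by rewrite /m; lia.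
pose f := RatCoef Af; exists f.
have derf (i j : 'I_n) : (i <= j)%N ->
    der (delta_mx i j) f = (\sum_k ((alpha k)%:R - (beta k)%:R) * (delta_mx i j : M) k k) *: f.
  move=> ij; apply: der_semiinvariant => // t g h hE.
  have upY : upper (1%:M + t *: delta_mx i j).
    move=> k l lk; rewrite !mxE -val_eqE /= (gtn_eqF lk) add0r.
    case: andP => [[/eqP ki /eqP lj]|_]; last by rewrite mulr0.
    by move: lk; rewrite ki lj ltnNge ij.
  have YE (c : 'I_n -> nat) : \prod_k (1 + t * (delta_mx i j : M) k k) ^+ c k =
      \prod_k (1%:M + t *: delta_mx i j : M) k k ^+ c k.
    by apply: eq_bigr => k _; rewrite !mxE eqxx.
  by rewrite !YE; exact: fY hE.
split.
- apply/eqP => f0; have := congr1 (fun f : rat_coef K n r s => f (GL1 K n)) f0.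
  by rewrite /= f1 => /eqP; rewrite oner_eq0.
- move=> i; rewrite derf // (bigD1 i) //= mxE eqxx mulr1 big1 ?addr0 => [|k ki].
    by rewrite mu_ab intrB.
  by rewrite mxE (negPf ki) mulr0.
move=> i j ij; rewrite derf ?(ltnW ij) // big1 ?scale0r // => k _; rewrite mxE.
case: andP => [[/eqP ki /eqP kj]|_]; last by rewrite mulr0.
by move: ij; rewrite -ki -kj ltnn.
Qed.

(** Right multiplication by a diagonal matrix scales column i of g and row i of its
inverse. *)
Lemma monomial_weight r s (a b : 'M[nat]_n) (f : rat_coef K n r s) S :
  rat_fun f = rat_monomial a b ->
  der (unit_sum K S) f =
   (((\sum_(i in S) \sum_k a k i)%N)%:R - ((\sum_(i in S) \sum_k b i k)%N)%:R) *: f.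
Proof.
move=> fE; set X := unit_sum K S.
have XE i j : X i j = ((i == j) && (i \in S))%:R.
  rewrite /X /unit_sum summxE big_mkcond (bigD1 i) //= big1 => [|k ki].
    by rewrite addr0 andbC; case: (i \in S); rewrite // mxE eqxx eq_sym.
  by case: ifP => // _; rewrite mxE eq_sym (negPf ki).
rewrite (@der_semiinvariant K n charK0 r s X f (fun i => \sum_k a k i)%N
  (fun i => \sum_k b i k)%N) //.
  congr (_ *: _); rewrite !natr_sum [X in X - _]big_mkcond [X in _ - X]big_mkcond -sumrB.
  apply: eq_bigr => i _; rewrite XE eqxx /=; case: (i \in S); first by rewrite mulr1.
  by rewrite mulr0 subrr.
move=> t g h hE; rewrite !fE; set D := fun i => 1 + t * X i i.
have hD k i : val h k i = val g k i * D i.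
  rewrite hE mulmxDr mulmx1 mxE -scalemxAr mxE [X in _ + _ * X]mxE (bigD1 i) //=.
  rewrite big1 => [|l /negPf li]; last by rewrite XE li mulr0.
  by rewrite addr0 /D; ring.
have gD i k : invmx (val g) i k = invmx (val h) i k * D i.
  have -> : invmx (val g) = (1%:M + t *: X) *m invmx (val h).
    apply: (can_inj (mulKmx (valP g))).
    by rewrite mulmxA -hE (mulmxV (valP h)) (mulmxV (valP g)).
  rewrite mulmxDl mul1mx mxE -scalemxAl mxE [X in _ + _ * X]mxE (bigD1 i) //=.
  rewrite big1 => [|l /negPf li]; last by rewrite XE eq_sym li mul0r.
  by rewrite addr0 /D; ring.
have prod_c : \prod_i \prod_j val h i j ^+ a i j =
    (\prod_i \prod_j val g i j ^+ a i j) * \prod_i D i ^+ (\sum_k a k i).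
  under [X in _ = _ * X]eq_bigr => i _ do rewrite expr_sum.
  rewrite [X in _ = _ * X]exchange_big -big_split; apply: eq_bigr => i _.
  by rewrite -big_split; apply: eq_bigr => j _; rewrite /= hD exprMn.
have prod_d : \prod_i \prod_j invmx (val g) i j ^+ b i j =
    (\prod_i \prod_j invmx (val h) i j ^+ b i j) * \prod_i D i ^+ (\sum_k b i k).
  under [X in _ = _ * X]eq_bigr => i _ do rewrite expr_sum.
  rewrite -big_split; apply: eq_bigr => i _.
  by rewrite -big_split; apply: eq_bigr => j _; rewrite /= gD exprMn.
rewrite /rat_monomial /coord_c /coord_d prod_c prod_d; ring.
Qed.

End HighestFunctions.

(** * A kernel acting by zero on all highest weights is zero *)

Section Injectivity.
Variables (K : fieldType) (n r s : nat).
Hypothesis charK0 : [pchar K] =i pred0.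
Variables (B : algType K) (P : B -> Prop).
Local Notation Q := (quot_alg P).
Local Notation M := 'M[K]_n.
Local Notation E := (@delta_mx K n n).
Variable qin : M -> Q.
Hypothesis qin_linear : linear qin.
Hypothesis qin_bracket : forall X Y, qin (X *m Y - Y *m X) = qin X * qin Y - qin Y * qin X.
Hypothesis Q_gen : forall C : Q -> Prop, C 1 ->
  (forall a x y, C x -> C y -> C (a *: x + y)) ->
  (forall X x, C x -> C (qin X * x)) -> forall x, C x.

Definition left_act (X : M) (q : Q) : Q := qin X * q.
(** The right multiplication is turned into a left action by transposition, which also
keeps weights and raising operators: e_ij with i < j acts as right multiplication
by the lowering e_ji. *)
Definition right_act (X : M) (q : Q) : Q := q * qin X^T.

Hypothesis rat_left : rational_module r s left_act.

Lemma left_module : gl_module left_act.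
Proof.
split=> [q a X Y|X a u v|X Y q]; rewrite /left_act.
- by rewrite qin_linear mulrDl -quot_scaleAl.
- by rewrite mulrDr -quot_scaleAr.
- by rewrite qin_bracket mulrBl !mulrA.
Qed.

Lemma right_module : gl_module right_act.
Proof.
split=> [q a X Y|X a u v|X Y q]; rewrite /right_act.
- by rewrite linearP qin_linear mulrDr -quot_scaleAr.
- by rewrite mulrDl -quot_scaleAl.
- by rewrite linearB /= !trmx_mul qin_bracket mulrBr !mulrA.
Qed.

(** Right and left multiplication by h have the same polynomial identities. *)
Lemma shifts_right (h : Q) (ls : seq K) :
  (forall q, shifts (fun q : Q => q * h : Q) ls q = q * shifts (fun q : Q => h * q : Q) ls 1) /\
  shifts (fun q : Q => h * q : Q) ls 1 * h = h * shifts (fun q : Q => h * q : Q) ls 1.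
Proof.
elim: ls => [|l ls [IH IHC]] /=; first by split=> [q|]; rewrite ?mulr1 ?mul1r.
split=> [q|]; last by rewrite mulrBl mulrBr -quot_scaleAl -quot_scaleAr -mulrA IHC.
by rewrite IH mulrBr -quot_scaleAr -mulrA IHC.
Qed.

Lemma unit_sum_tr (S : {set 'I_n}) : (unit_sum K S)^T = unit_sum K S.
Proof. by rewrite /unit_sum linear_sum; apply: eq_bigr => i _; rewrite /= trmx_delta. Qed.

Lemma rat_right : rational_module r s right_act.
Proof.
move=> S; have [L LP Lv] := rat_left S; exists L => // q.
rewrite /right_act unit_sum_tr (proj1 (shifts_right _ _)).
by apply: etrans (congr1 ( *%R q) (Lv 1)) _; rewrite mulr0.
Qed.

(** The idempotent of the weight mu, built one index at a time: \prod_(l != mu_i) (h_i - l),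
normalized, projects to the mu_i-eigenspace because the allowed eigenvalues of h_i
are distinct, and acts on x from the right as the identity. *)
Lemma weight_unit x mu : weight right_act mu x -> x != 0 ->
  exists2 e : Q, weight left_act mu e & x * e = x.
Proof.
move=> wx x0; suff step (l : seq 'I_n) : exists2 e : Q,
    {in l, forall i, qin (E i i) * e = (mu i)%:~R *: e} & x * e = x.
  by have [e el xe] := step (enum 'I_n); exists e => // i; apply: el; rewrite mem_enum.
elim: l => [|i l [e el xe]]; first by exists 1; rewrite ?mulr1.
set h := qin (E i i); set m : K := (mu i)%:~R.
have xh : x * h = m *: x by have := wx i; rewrite /right_act trmx_delta.
pose T (q : Q) := h * q.
have linT : linear T := gl_linV left_module (E i i).
have [L [uL _] Lv] := rat_left [set i]; rewrite /unit_sum big_set1 in Lv.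
have xT ls : x * shifts T ls e = (\prod_(k <- ls) (m - k)) *: x.
  elim: ls => [|k ls IH] /=; first by rewrite big_nil scale1r.
  by rewrite mulrBr /T mulrA xh -quot_scaleAl -quot_scaleAr IH big_cons mulrBl scalerBl !scalerA.
have uLK : uniq [seq k%:~R : K | k <- L] by rewrite map_inj_uniq //; exact: intr_inj_char0.
have mL : m \in [seq k%:~R : K | k <- L].
  have /eqP := xT [seq k%:~R | k <- L]; rewrite [shifts _ _ _]Lv mulr0 eq_sym.
  by rewrite scaler_eq0 (negPf x0) orbF prodf_seq_eq0 => /hasP[k kL /=];
    rewrite subr_eq0 => /eqP->.
case/splitPr: mL uLK (Lv e) => ls1 ls2 uLK Le.
pose ls := ls1 ++ ls2; pose c := \prod_(k <- ls) (m - k).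
have c0 : c != 0.
  rewrite prodf_seq_neq0; apply/allP => k kls /=; rewrite subr_eq0.
  apply/eqP => mk; move: uLK; rewrite -cat_rcons cat_uniq => /and3P[].
  rewrite rcons_uniq => /andP[m1 _] /hasPn m2 _; move: kls; rewrite mem_cat => /orP[].
    by rewrite -mk (negPf m1).
  by move=> /m2; rewrite mem_rcons inE mk eqxx.
exists (c^-1 *: shifts T ls e); last first.
  by rewrite -quot_scaleAr xT scalerA mulVf // scale1r.
move=> k; rewrite inE => /orP[/eqP->|kl].
  rewrite -quot_scaleAr -/h -[h * _]/(T _); have /eqP := etrans (shifts_rot linT m ls1 ls2 e) Le.
  rewrite subr_eq0 => /eqP ->; by rewrite !scalerA mulrC.
rewrite -quot_scaleAr.
have br0 : E i i *m E k k - E k k *m E i i = 0.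
  by rewrite !delta_mulE; case: (eqVneq i k) => [->|_]; rewrite ?scale0r subrr.
have comm u : T (qin (E k k) * u) = qin (E k k) * T u.
  rewrite -[LHS]/(left_act (E i i) (left_act (E k k) u)) (rho_comm left_module).
  by rewrite br0 (rho0 left_module) addr0.
have -> : qin (E k k) * shifts T ls e = shifts T ls (qin (E k k) * e).
  exact: esym (shifts_comm ls e (gl_linV left_module (E k k)) comm).
rewrite el //.
rewrite -[_ *: e]addr0 (shifts_linear linT) (shifts0 linT) addr0.
by rewrite !scalerA mulrC.
Qed.

Variables (W : lmodType K) (act : Q -> W -> W).
Hypothesis actQ : ring_action act.
Hypothesis actZ : forall a q w, act (a *: q) w = a *: act q w.
Hypothesis W_highest : forall mu, dominant mu ->
  (forall S : {set 'I_n}, - s%:Z <= \sum_(i in S) mu i <= r%:Z) ->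
  \sum_i mu i = r%:Z - s%:Z ->
  exists w : W, [/\ w != 0, weight (fun X => act (qin X)) mu w
    & highest (fun X => act (qin X)) w].

Definition pair_act (q : Q) (v : Q * W) : Q * W := (q * v.1, act q v.2).

Lemma pair_module : gl_module (fun X => pair_act (qin X)).
Proof.
have actN q w : act (- q) w = - act q w by rewrite -[- q]scaleN1r actZ scaleN1r.
split=> [[q w] a X Y|X a [q w] [q' w']|X Y [q w]]; apply: (congr2 pair) => /=.
- by rewrite qin_linear mulrDl -quot_scaleAl.
- by rewrite qin_linear (actionD actQ) actZ.
- by rewrite mulrDr -quot_scaleAr.
- exact: (action_linear actQ).
- by rewrite qin_bracket mulrBl !mulrA.
- by rewrite qin_bracket (actionD actQ) actN !(actionM actQ).
Qed.

Hypothesis total : qin (unit_sum K [set: 'I_n]) = (r%:Z - s%:Z)%:~R *: (1 : Q).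

(** A nonzero kernel contains some y highest of weight lam on the left and highest of
weight mu on the right. Splitting the idempotent e of weight mu as z + n^- Q gives
y z = y, since y kills n^- from the left. In the submodule of Q * W generated by
the highest vector (z, f) of weight mu, the vector y (z, f) = (y, 0) is highest of
weight lam. The central Casimir element has the value of mu there, so lam, which is
below mu, has the height of mu, and (y, 0) is a multiple of (z, f); as f is nonzero,
y = 0. *)
Lemma kernel_trivial x : (forall w, act x w = 0) -> x = 0.
Proof.
move=> x_ker; apply/eqP/negPn/negP => x0.
pose ker (y : Q) := forall w, act y w = 0.
have ker_lin a u v : ker u -> ker v -> ker (a *: u + v).
  by move=> ku kv w; rewrite (actionD actQ) actZ ku kv scaler0 addr0.
have act0 q : act q 0 = 0.
  by have := action_linear actQ q (-1) 0 0; rewrite scaler0 addr0 scaleN1r addNr.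
have ker_l X u : ker u -> ker (left_act X u).
  by move=> ku w; rewrite /left_act (actionM actQ) ku act0.
have ker_r X u : ker u -> ker (right_act X u).
  by move=> ku w; rewrite /right_act (actionM actQ) ku.
have [lam [x1 [wx1 hx1 kx1 x1_neq0]]] :=
  highest_ex charK0 left_module rat_left ker_lin ker_l x_ker x0.
pose C y := [/\ ker y, weight left_act lam y & highest left_act y].
have lr X Y q : left_act X (right_act Y q) = right_act Y (left_act X q).
  by rewrite /left_act /right_act mulrA.
have C_lin a u v : C u -> C v -> C (a *: u + v).
  case=> [ku wu hu] [kv wv hv]; split; first exact: ker_lin.
    exact: (weight_lin left_module).
  exact: (highest_lin left_module).
have C_r X u : C u -> C (right_act X u).
  case=> [ku wu hu]; split; first exact: ker_r.
    move=> i; rewrite lr wu -[_ *: u]addr0 (gl_linV right_module).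
    by rewrite [right_act X 0]mul0r addr0.
  by move=> i j ij; rewrite lr hu // /right_act mul0r.
have [mu [y [wy hy [ky wly hly] y0]]] :=
  highest_ex charK0 right_module rat_right C_lin C_r (And3 kx1 wx1 hx1) x1_neq0.
have dmu : dominant mu := highest_dominant charK0 right_module rat_right wy hy y0.
have mu_rs (S : {set 'I_n}) := weight_range charK0 right_module rat_right S wy y0.
have dlam : dominant lam := highest_dominant charK0 left_module rat_left wly hly y0.
have [f [f0 wf hf]] : exists w : W, [/\ w != 0, weight (fun X => act (qin X)) mu w
    & highest (fun X => act (qin X)) w].
  apply: W_highest => //; apply: (intr_inj_char0 charK0); apply/eqP.
  rewrite -subr_eq0; have := weight_unit_sum right_module [set: 'I_n] wy.
  rewrite /right_act unit_sum_tr total -quot_scaleAr mulr1 => /esym /eqP.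
  rewrite -subr_eq0 -scalerBl scaler_eq0 (negPf y0) orbF.
  by rewrite (eq_bigl xpredT) // => i; rewrite inE.
have [e we ye] := weight_unit wy y0.
have [z [wz hz] low] := weight_split charK0 left_module rat_left dmu we.
have yz : y * z = y.
  suff : y * (e - z) = 0.
    by rewrite mulrBr ye => /eqP; rewrite subr_eq0 => /eqP <-.
  elim: low => [u [i [j [q [ij ->]]]]||u v _ IHu _ IHv|a u _ IHu].
  - rewrite /left_act mulrA; have := hy i j ij; rewrite /right_act trmx_delta => ->.
    by rewrite mul0r.
  - by rewrite mulr0.
  - by rewrite mulrDr IHu IHv addr0.
  - by rewrite -quot_scaleAr IHu scaler0.
pose rho (X : M) := pair_act (qin X).
have ww : weight rho mu (z, f) by move=> i; rewrite /rho /pair_act /= [qin _ * z]wz wf.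
have hw : highest rho (z, f).
  by move=> i j ij; rewrite /rho /pair_act /= [qin _ * z]hz // hf.
have yw : pair_act y (z, f) = (y, 0) by rewrite /pair_act /= yz ky.
have oy : orbit rho mu (z, f) (y, 0).
  rewrite -yw; move: y {wy hy ky wly hly y0 ye yz yw}.
  apply: Q_gen => [|a u v ou ov|X u ou].
  - have -> : pair_act 1 (z, f) = (z, f) by rewrite /pair_act /= mul1r (action1 actQ).
    exact: orbit_self.
  - have -> : pair_act (a *: u + v) (z, f) = a *: pair_act u (z, f) + pair_act v (z, f).
      by rewrite /pair_act mulrDl -quot_scaleAl (actionD actQ) actZ.
    by apply: span_D => //; exact: span_Z.
  - have -> : pair_act (qin X * u) (z, f) = rho X (pair_act u (z, f)).
      by rewrite /rho /pair_act /= mulrA (actionM actQ).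
    exact: (orbit_rho pair_module ww hw).
have wy0 : weight rho lam (y, 0).
  by move=> i; apply: (congr2 pair); rewrite /= ?act0 ?scaler0 //; exact: wly.
have hy0 : highest rho (y, 0).
  by move=> i j ij; rewrite /rho /pair_act /= act0 [qin _ * y]hly.
have y00 : ((y, 0) : Q * W) != 0 by apply: contraNneq y0 => -[->].
have le : weight_le lam mu := orbit_weight_le charK0 pair_module ww oy wy0 y00.
have cas_orbit := orbit_casimir pair_module ww hw.
have cas_eq : casimir_value lam = casimir_value mu.
  apply: (intr_inj_char0 charK0); apply/eqP; rewrite -subr_eq0.
  have := cas_orbit _ oy; rewrite (casimir_highest pair_module wy0 hy0) => /eqP.
  by rewrite -subr_eq0 -scalerBl scaler_eq0 (negPf y00) orbF.
have h_eq : height lam = height mu.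
  apply/eqP; rewrite eq_le (le _ (@two_rho_dominant n)) leNgt /=.
  apply/negP => lt; have := casimir_value_lt dlam dmu le lt.
  by rewrite cas_eq ltxx.
have [k] := orbit_top charK0 pair_module ww oy wy0 h_eq.
case=> yk /esym /eqP; rewrite scaler_eq0 (negPf f0) orbF => /eqP k0.
by move: y0; rewrite yk k0 scale0r eqxx.
Qed.

End Injectivity.

(** * The morphism to the Schur algebra, and its surjectivity *)

Section DualSpan.
Variables (K : fieldType) (A : lmodType K).
Local Notation span l := (lin_span (fun f : A => f \in l)).

Lemma span_sub (l l' : seq A) f : {subset l <= l'} -> span l f -> span l' f.
Proof.
move=> sub; elim=> [u /sub u'||u v _ IHu _ IHv|a u _ IHu].
- exact: span_gen.
- exact: span_0.
- exact: span_D.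
- exact: span_Z.
Qed.

(** A subspace of the dual that separates points realizes every functional on a finite
set: eliminate one vector x of the list at a time, passing to the functionals that
vanish at x. *)
Lemma dual_interpolation (l : seq A) (V : dual A -> Prop) (phi : dual A) :
  (forall a u v, V u -> V v -> V (a *: u + v)) -> V 0 ->
  (forall f, span l f -> (forall psi, V psi -> psi f = 0) -> phi f = 0) ->
  exists2 psi, V psi & {in l, forall f, psi f = phi f}.
Proof.
elim: l V phi => [|x l IH] V phi V_lin V0 vanish; first by exists 0.
have sub : {subset l <= x :: l} by move=> y; rewrite inE orbC => ->.
have [[psi0 [Vpsi0 psi0x]]|none] := pselect (exists psi, V psi /\ psi x != 0); last first.
  have V_x psi : V psi -> psi x = 0.
    by move=> Vpsi; apply/eqP/negPn/negP => px; apply: none; exists psi.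
  have [f lf|psi Vpsi psiE] := IH V phi V_lin V0; first exact: vanish (span_sub sub lf).
  exists psi => // f; rewrite inE => /orP[/eqP->|/psiE //].
  rewrite V_x // vanish //; apply: span_gen; exact: mem_head.
have VZ a u : V u -> V (a *: u) by move=> Vu; rewrite -[_ *: u]addr0; exact: V_lin.
pose psi1 : dual A := ((psi0 x : K)^-1 : K) *: psi0.
have Vpsi1 : V psi1 by exact: VZ.
have psi1x : psi1 x = 1 by exact: mulVf.
have dE (a : K) (u v : dual A) f : (a *: u + v) f = a * u f + v f by [].
have pE (u : dual A) (a : K) v w : u (a *: v + w) = a * u v + u w.
  exact: dual_linear.
pose V1 psi := V psi /\ psi x = 0.
have [a u v [Vu ux] [Vv vx]||f lf V1f|psi [Vpsi psix] psiE] :=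
  IH V1 ((- (phi x : K)) *: psi1 + phi).
- by split; [exact: V_lin|rewrite dE ux vx mulr0 addr0].
- by [].
- have : phi ((- (psi1 f : K)) *: x + f) = 0.
    apply: vanish => [|psi Vpsi].
      apply: span_D; last exact: span_sub lf.
      by apply: span_Z; apply: span_gen; exact: mem_head.
    have := V1f ((- (psi x : K)) *: psi1 + psi); rewrite dE => V1psi.
    rewrite pE mulNr mulrC -mulNr; apply: V1psi.
    by split; [exact: V_lin|rewrite dE psi1x mulr1 addNr].
  by rewrite pE dE mulNr mulrC -mulNr.
exists ((phi x : K) *: psi1 + psi); first exact: V_lin.
move=> f; rewrite inE dE => /orP[/eqP->|/psiE ->].
  by rewrite psi1x mulr1 psix addr0.
by rewrite dE mulNr addNKr.
Qed.

End DualSpan.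

Section Coefficients.
Variables (K : fieldType) (n r s : nat).
Hypothesis charK0 : [pchar K] =i pred0.
Local Notation A := (rat_coef K n r s).
Local Notation M := 'M[K]_n.
Local Notation one := (GL1 K n).

Lemma rat_coef_ind (C : A -> Prop) :
  (forall a b f, exp_total a = r -> exp_total b = s -> rat_fun f = rat_monomial a b -> C f) ->
  C 0 -> (forall a f g, C f -> C g -> C (a *: f + g)) -> forall f, C f.
Proof.
move=> C_mon C0 C_lin f.
suff [g [gf Cg]] : exists g : A, rat_fun g = rat_fun f /\ C g.
  by rewrite -(_ : g = f) //; apply: rat_coefP => h; rewrite gf.
case: f => f /= /asboolP; elim=> [_ [a b ra sb]||u v _ [g [gu Cg]] _ [h [hv Ch]]|a u _ [g [gu Cg]]].
- have Af : rat_monomial a b \in @in_rat_coef K n r s by apply/asboolP; apply: span_gen.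
  by exists (RatCoef Af); split=> //; exact: (C_mon a b).
- by exists 0.
- by exists (1 *: g + h); split; [rewrite scale1r -gu -hv|exact: C_lin].
- by exists (a *: g + 0); split; [rewrite addr0 -gu|exact: C_lin].
Qed.

(** The exponents of a monomial of degree (r, s) are at most r and s, so they are
ordinals. *)
Lemma rat_coef_finite : exists l : seq A, forall f : A, lin_span (fun g => g \in l) f.
Proof.
pose mon (p : 'M['I_r.+1]_n * 'M['I_s.+1]_n) : A :=
  insubd (0 : A) (rat_monomial (map_mx val p.1) (map_mx val p.2)).
exists [seq mon p | p <- enum {: 'M['I_r.+1]_n * 'M['I_s.+1]_n}] => f.
have le_total (a : 'M[nat]_n) i j : (a i j <= exp_total a)%N.
  by rewrite /exp_total (bigD1 i) //= (bigD1 j) //= -addnA leq_addr.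
elim/rat_coef_ind: f => [a b f ra sb fE||a f g f0 g0].
- apply: span_gen; apply/mapP; exists (map_mx inord a, map_mx inord b).
    by rewrite mem_enum.
  have ab : rat_monomial (map_mx val (map_mx inord a : 'M['I_r.+1]_n))
      (map_mx val (map_mx inord b : 'M['I_s.+1]_n)) = rat_fun f.
    rewrite fE; congr rat_monomial; apply/matrixP => i j.
      by rewrite !mxE /= inordK // ltnS -ra.
    by rewrite !mxE /= inordK // ltnS -sb.
  apply: val_inj; rewrite /mon ab insubdK //; exact: valP f.
- exact: span_0.
- by apply: span_D => //; exact: span_Z.
Qed.

(** On a monomial H_S acts by the sum of the c exponents in the columns of S minus the
sum of the d exponents in the rows of S, an integer between -s and r. *)
Lemma der_shift (S : {set 'I_n}) (f : A) :
  shifts (der (unit_sum K S)) [seq (- (j%:Z - r%:Z))%:~R | j <- index_iota 0 (r + s).+1] f = 0.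
Proof.
have linT := gl_linV (@der_module K n charK0 r s) (unit_sum K S).
elim/rat_coef_ind: f => [a b f ra sb fE||a f g f0 g0].
- rewrite (shifts_eigen linT _ (monomial_weight charK0 S fE)).
  set x := (\sum_(i in S) _)%N; set y := (\sum_(i in S) _)%N.
  have xr : (x <= r)%N.
    rewrite -ra /exp_total exchange_big /x [X in (_ <= X)%N](bigID (mem S)) /=.
    exact: leq_addr.
  have ys : (y <= s)%N.
    rewrite -sb /exp_total /y [X in (_ <= X)%N](bigID (mem S)) /=.
    exact: leq_addr.
  suff -> : \prod_(l <- [seq (- (j%:Z - r%:Z))%:~R | j <- index_iota 0 (r + s).+1])
     (x%:R - y%:R - l) = 0 :> K by rewrite scale0r.
  (* The eigenvalue x - y is r - j for j = r + y - x. *)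
  apply/eqP; rewrite prodf_seq_eq0; apply/hasP.
  exists (x%:R - y%:R); last by rewrite /= subrr.
  apply/mapP; exists (r + y - x)%N; first by rewrite mem_index_iota; lia.
  rewrite !pmulrn -intrB; congr (_%:~R); lia.
- exact: shifts0.
- by rewrite (shifts_linear linT) f0 g0 scaler0 addr0.
Qed.

Lemma der_total (f : A) : der (unit_sum K [set: 'I_n]) f = (r%:R - s%:R) *: f.
Proof.
have linT := gl_linV (@der_module K n charK0 r s) (unit_sum K [set: 'I_n]).
elim/rat_coef_ind: f => [a b f ra sb fE||a f g f0 g0].
- rewrite (monomial_weight charK0 _ fE); congr (_ *: _).
  rewrite -[in RHS]ra -[in RHS]sb /exp_total [in RHS]exchange_big.
  by congr (_%:R - _%:R); apply: eq_bigl => i; rewrite inE.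
- by have := linT (-1) 0 0; rewrite !scaler0 addr0 scaleN1r addNr => ->.
- by rewrite linT f0 g0 scalerDr !scalerA [a * _]mulrC.
Qed.

Variables (B : algType K) (P : B -> Prop).
Local Notation Q := (quot_alg P).
Variable qin : M -> Q.
Hypothesis Q_gen : forall C : Q -> Prop, C 1 ->
  (forall a x y, C x -> C y -> C (a *: x + y)) ->
  (forall X x, C x -> C (qin X * x)) -> forall x, C x.
Variable act : Q -> A -> A.
Hypothesis actQ : ring_action act.
Hypothesis actZ : forall a q f, act (a *: q) f = a *: act q f.
Hypothesis act_qin : forall X f, act (qin X) f = der X f.

(** Left translations commute with the action, which is by left-invariant derivations. *)
Lemma act_translate q f g : act q (rat_translate f g) = rat_translate (act q f) g.
Proof.
elim/Q_gen: q f => [|a x y IHx IHy|X x IH] f.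
- by rewrite !(action1 actQ).
- by rewrite !(actionD actQ) !actZ IHx IHy; exact: rat_coefP.
- by rewrite !(actionM actQ) IH !act_qin der_translate.
Qed.

Fact schur_map_subproof q : (fun f : A => act q f one : K^o) \in @linear_form K A.
Proof. by apply/asboolP => a f g; rewrite (action_linear actQ). Qed.
Definition schur_map q : rat_schur K n r s := Dual (schur_map_subproof q).

(** Slicing the comultiplication by the functional f |-> (q f)(1) gives back q f; this
turns the composition of actions into convolution. *)
Lemma rat_slice_schur_map q f : rat_slice (schur_map q) f = act q f.
Proof.
apply: rat_coefP => g; rewrite /= act_translate /=.
by congr (rat_fun _ _); apply: val_inj; rewrite /= mulmx1.
Qed.

Lemma schur_map_linear : linear schur_map.
Proof. by move=> a x y; apply: dualP => f /=; rewrite (actionD actQ) actZ. Qed.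

Lemma schur_map_monoid : GRing.monoid_morphism schur_map.
Proof.
split; first by apply: dualP => f /=; rewrite (action1 actQ).
move=> x y; apply: dualP => f.
rewrite -[RHS]/(schur_map x (rat_slice (schur_map y) f)) rat_slice_schur_map /=.
by rewrite (actionM actQ).
Qed.

Lemma schur_map_ker q : schur_map q = 0 -> forall f, act q f = 0.
Proof.
move=> q0 f; rewrite -rat_slice_schur_map q0; exact: rat_coefP.
Qed.

(** The functions on which the image vanishes are stable under derivations and vanish
at 1, hence are zero, so the image separates the points of A(n,r,s). *)
Lemma schur_map_surj psi : exists q, schur_map q = psi.
Proof.
have [l lA] := rat_coef_finite.
have [a u v [x <-] [y <-]|||_ [q <-] qpsi] :=
  @dual_interpolation K A l (fun phi => exists q, schur_map q = phi) psi.
- by exists (a *: x + y); rewrite schur_map_linear.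
- by exists 0; have := schur_map_linear (-1) 0 0; rewrite scaler0 addr0 scaleN1r addNr.
- move=> f _ f0; suff -> : f = 0 by rewrite linear0.
  apply: (der_vanish charK0 (C := fun f => forall q, act q f one = 0)) => [X g g0 q|g g0|q].
  + by rewrite -act_qin -(actionM actQ).
  + by rewrite -(action1 actQ g).
  + by have := f0 (schur_map q); apply; exists q.
exists q; apply: dualP => f; elim: (lA f) => [g /qpsi//||g h _ IHg _ IHh|a g _ IHg].
- by rewrite !linear0.
- have dD (u : rat_schur K n r s) : u (g + h) = u g + u h by exact: linearD.
  by rewrite !dD IHg IHh.
- have dZ (u : rat_schur K n r s) : u (a *: g) = a * u g by exact: linearZ.
  by rewrite !dZ IHg.
Qed.

End Coefficients.

(** * The defining relations as operator identities *)

Section Relations.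
Variables (K : fieldType).

Lemma action_shift (A : algType K) (V : lmodType K) (act : A -> V -> V)
    (c : nat -> int) (l : seq nat) (h : A) v : ring_action act ->
  (forall a x v, act (a *: x) v = a *: act x v) ->
  act (\prod_(j <- l) (h + (c j)%:~R)) v = shifts (act h) [seq (- c j)%:~R | j <- l] v.
Proof.
move=> actA actZ; elim: l => [|j l IH]; first by rewrite big_nil (action1 actA).
rewrite big_cons (actionM actA) (actionD actA) /= IH; congr (_ + _).
have -> : (c j)%:~R = ((c j)%:~R : K) *: (1 : A) by rewrite scaler_int.
by rewrite actZ (action1 actA) mulrNz scaleNr opprK.
Qed.

Lemma quot_scalar (A : algType K) (P : A -> Prop) (z : int) :
  quot_proj P z%:~R = (z%:~R : K) *: (1 : quot_alg P).
Proof.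
have -> : z%:~R = (z%:~R : K) *: (1 : A) by rewrite scaler_int.
by apply: etrans (linearZZ (quot_proj P) _ _) _; rewrite rmorph1.
Qed.

Lemma quot_shift (A : algType K) (P : A -> Prop) (c : nat -> int) (l : seq nat) (h : A)
    (q : quot_alg P) : P (\prod_(j <- l) (h + (c j)%:~R)) ->
  shifts (fun q : quot_alg P => quot_proj P h * q : quot_alg P) [seq (- c j)%:~R | j <- l] q = 0.
Proof.
move=> Pl; have -> : 0 = quot_proj P (\prod_(j <- l) (h + (c j)%:~R)) * q.
  rewrite (_ : quot_proj P _ = 0) ?mul0r // -(rmorph0 (quot_proj P)).
  by apply/quot_projP; rewrite subr0; exact: ideal_gen.
elim: l {Pl} => [|j l IH] /=; first by rewrite big_nil rmorph1 mul1r.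
rewrite IH big_cons rmorphM -mulrA rmorphD mulrDl; congr (_ + _).
by rewrite /= quot_scalar -quot_scaleAl mul1r mulrNz scaleNr opprK.
Qed.

Lemma quot_total (A : algType K) (P : A -> Prop) (h : A) (r s : nat) :
  P (h - r%:R + s%:R) -> quot_proj P h = (r%:Z - s%:Z)%:~R *: (1 : quot_alg P).
Proof.
move=> Ph; have : quot_proj P (h - r%:R + s%:R) = 0.
  by rewrite -(rmorph0 (quot_proj P)); apply/quot_projP; rewrite subr0; exact: ideal_gen.
rewrite -addrA [- _ + _]addrC -opprB rmorphB => /eqP; rewrite subr_eq0 => /eqP ->.
by rewrite -quot_scalar intrB.
Qed.

Lemma action_total (A : algType K) (V : lmodType K) (act : A -> V -> V) (h : A) (r s : nat) v :
  ring_action act -> (forall a x v, act (a *: x) v = a *: act x v) ->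
  act h v = (r%:R - s%:R) *: v -> act (h - r%:R + s%:R) v = 0.
Proof.
move=> actA actZ hv; have -> : h - r%:R + s%:R = h + (- (r%:R - s%:R)) *: 1.
  by rewrite -addrA scaleNr scalerBl !scaler_nat opprB [- _ + _]addrC.
by rewrite (actionD actA) actZ (action1 actA) hv scaleNr subrr.
Qed.
End Relations.

Section Concrete.
Variables (K : fieldType) (n r s : nat).
Hypothesis charK0 : [pchar K] =i pred0.
Local Notation A := (rat_coef K n r s).
Local Notation rel := (@rat_rel K n r s).
Local Notation Q := (quot_alg rel).
Local Notation qin := (@Qin K n r s).

Lemma Hset_in (S : {set 'I_n}) : Hset K S = Ugl_in (unit_sum K S).
Proof. by rewrite /unit_sum linear_sum. Qed.

Lemma Qin_total : qin (unit_sum K [set: 'I_n]) = (r%:Z - s%:Z)%:~R *: (1 : Q).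
Proof.
apply: quot_total; rewrite -Hset_in /Hset.
have := rat_rel_total K n r s; congr rat_rel.
by congr (_ - _ + _); apply: eq_bigl => i; rewrite inE.
Qed.

Lemma Qin_rational : rational_module r s (left_act (qin : 'M[K]_n -> Q)).
Proof.
move=> S; have [Sp|] := boolP (S \proper [set: 'I_n]).
  exists [seq - (j%:Z - r%:Z) | j <- index_iota 0 (r + s).+1].
    split=> [|l /mapP [j]].
      rewrite map_inj_uniq ?iota_uniq // => i j; lia.
    by rewrite mem_index_iota => jrs ->; lia.
  move=> q; rewrite -map_comp; apply: quot_shift; rewrite -Hset_in.
  exact: rat_rel_proper.
rewrite properEneq subsetT andbT negbK => /eqP ->.
exists [:: r%:Z - s%:Z].
  by split=> // l; rewrite inE => /eqP ->; lia.
by move=> q /=; rewrite /left_act Qin_total -quot_scaleAl mul1r subrr.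
Qed.

Local Notation der := (@der K n r s).
Let mod := @der_module K n charK0 r s.

Lemma rat_rel_act x f : rel x -> Uact der x f = 0.
Proof.
have UactZ := UactZ mod; have Uactr := Uact_action mod.
have shift (S : {set 'I_n}) g : Uact der (shifted_prod r s (Hset K S)) g = 0.
  rewrite (action_shift _ _ _ _ Uactr UactZ) Hset_in -[RHS](der_shift charK0 S g).
  by apply: eq_shifts => u; exact: Uact_in.
have total : Uact der (\sum_i Hgen K i) f = (r%:R - s%:R) *: f.
  rewrite -der_total // -(Uact_in mod) -Hset_in; congr (Uact der _ f).
  by apply: eq_bigl => i; rewrite inE.
case=> [|i|S _].
- exact: (action_total Uactr UactZ).
- by have := shift [set i] f; rewrite /Hset big_set1.
- exact: shift.
Qed.

Definition Qact : Q -> A -> A := @quot_act K A _ (Uact der) rel.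

Lemma Qact_action : ring_action Qact.
Proof. exact: (quot_act_action (Uact_action mod) (UactZ mod) rat_rel_act). Qed.

Lemma QactZ a (q : Q) f : Qact (a *: q) f = a *: Qact q f.
Proof. exact: (quot_actZ (Uact_action mod) (UactZ mod) rat_rel_act). Qed.

Lemma Qact_in X f : Qact (qin X) f = der X f.
Proof.
rewrite /Qact (quot_actE (Uact_action mod) (UactZ mod) rat_rel_act).
exact: Uact_in mod X f.
Qed.

End Concrete.

(** * The isomorphism *)

Theorem proposition2p3 (K : closedFieldType) (charK0 : [pchar K] =i pred0)
    (n r s : nat) (n_gt0 : (0 < n)%N) :
  exists phi : quot_alg (@rat_rel K n r s) -> rat_schur K n r s,
    [/\ linear phi,
        GRing.monoid_morphism phi,
        bijective phi
      & forall (X : 'M[K]_n) (a b : 'M[nat]_n) (f : rat_coef K n r s),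
          exp_total a = r -> exp_total b = s ->
          rat_fun f = rat_monomial a b ->
          dual_fun (phi (quot_proj (@rat_rel K n r s) (Ugl_in X))) f
            = tangent_monomial X a b].
Proof.
have actQ := @Qact_action K n r s charK0.
have actZ := @QactZ K n r s charK0.
have act_in := @Qact_in K n r s charK0.
have Qgen := @Q_ind K n r s.
pose phi := schur_map actQ.
have phi_lin : linear phi := schur_map_linear actQ actZ.
exists phi; split=> //.
- exact: (schur_map_monoid charK0 Qgen actQ actZ act_in).
- have inj : injective phi.
    move=> x y xy; apply/eqP; rewrite -subr_eq0; apply/eqP.
    have ker : phi (x - y) = 0.
      by rewrite addrC -[- y]scaleN1r phi_lin xy scaleN1r addNr.
    have act0 := schur_map_ker charK0 Qgen actZ act_in ker.
    apply: (kernel_trivial charK0 (@Qin_linear K n r s) (@Qin_bracket K n r s) Qgen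
      (@Qin_rational K n r s) actQ actZ _ (Qin_total K n r s) act0).
    move=> mu dmu mu_rs mu_tot.
    have [f [f0 wf hf]] := highest_function charK0 n_gt0 dmu mu_rs mu_tot.
    by exists f; split=> // [i|i j ij]; rewrite act_in; [exact: wf|exact: hf].
  have surj := schur_map_surj charK0 actQ actZ act_in.
  exists (fun psi => projT1 (cid (surj psi))) => [q|psi].
    by apply: inj; case: cid.
  by case: cid.
- move=> X a b f ra sb fE.
  rewrite -(tangent_der charK0 X ra sb fE) -act_in.
  by [].
Qed.
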